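(* Suppose ${\bf E}\,\xi^-=\infty$ and $$\int_0^\infty \frac{x}{m(x)}\,F(dx)<\infty .$$ Let the distribution $F$ be long-tailed and let the distribution $G_1$ on $[0,\infty)$ with tail $$\overline G_1(x)=\min\Biggl(1,\int_0^\infty \overline F(x+t)\,d\frac{t}{m(t)}\Biggr),\quad x\ge 0,$$ be subexponential. Then $$1\le \liminf_{x\to\infty}\frac{{\bf P}\{M>x\}}{\overline G_1(x)}\le \limsup_{x\to\infty}\frac{{\bf P}\{M>x\}}{\overline G_1(x)}\le 2 .$$
   Context: Let $\xi,\xi_1,\xi_2,\ldots$ be independent real random variables with common non-degenerate distribution $F$ on ${\bf R}$. For a distribution $G$, write $G(x)=G((-\infty,x])$ and $\overline G(x)=G((x,\infty))$. Put $S_0=0$, $S_n=\xi_1+\cdots+\xi_n$, $M=\sup\{S_n: n\ge 0\}$. Let $\xi^-=\max\{-\xi,0\}$ and let $$m(x)={\bf E}\min\{\xi^-,x\}=\int_0^x{\bf P}\{\xi^->y\}\,dy,\quad x\ge 0,$$ be the negative truncated mean function. The function $t\mapsto t/m(t)$ is continuous and nondecreasing on $(0,\infty)$, and integrals against $d\frac{t}{m(t)}$ are Lebesgue–Stieltjes integrals over $(0,\infty)$. (When ${\bf E}\xi^-=\infty$, finiteness of $\int_0^\infty \frac{x}{m(x)}F(dx)$ is equivalent to $M<\infty$ a.s.) A distribution $G$ is long-tailed if, for every fixed $t$, $\overline G(x+t)/\overline G(x)\to 1$ as $x\to\infty$ (in particular $\overline G(x)>0$ for all $x$). A distribution $G$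 on $[0,\infty)$ with unbounded support is subexponential if $\overline{G*G}(x)\sim 2\overline G(x)$ as $x\to\infty$, where $*$ denotes convolution and $f\sim g$ means $f/g\to 1$. *)

(* Defs.v *)
From HB Require Import structures.
From mathcomp Require Import all_boot all_order all_algebra.
From mathcomp Require Import finmap.
From mathcomp Require Import all_classical all_reals all_analysis.
From mathcomp Require Import measurable_realfun.

Set Implicit Arguments.
Unset Strict Implicit.
Unset Printing Implicit Defensive.
Import Order.TTheory GRing.Theory Num.Theory.
Import numFieldNormedType.Exports.
Local Open Scope classical_set_scope.
Local Open Scope ring_scope.

Definition independent_RVs d (T : measurableType d) (R : realType)
    (P : probability T R) (X : nat -> {RV P >-> R}) : Prop :=
  forall (J : {fset nat}) (B : nat -> set R),
    (forall k, measurable (B k)) ->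
    P (\bigcap_(k in [set` J]) (X k @^-1` B k)) =
    (\prod_(k <- J) P (X k @^-1` B k))%E.

Definition tail (R : realType) (G : set R -> \bar R) (x : R) : R :=
  fine (G `]x, +oo[%classic).

Definition long_tailed (R : realType)
    (G : probability (measurableTypeR R) R) : Prop :=
  (forall x, 0 < tail G x) /\
  (forall t, (tail G (x + t) / tail G x) @[x --> +oo] --> (1 : R)).

Definition convolution (R : realType)
    (G H : probability (measurableTypeR R) R) : set R -> \bar R :=
  pushforward (G \x H)%E (fun z => z.1 + z.2).

Definition subexponential (R : realType)
    (G : probability (measurableTypeR R) R) : Prop :=
  [/\ G `[0, +oo[%classic = 1%E,
      forall x, 0 < tail G x &
      (tail (convolution G G) x / (2 * tail G x)) @[x --> +oo] --> (1 : R)].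

Section truncated_mean.
Context d (T : measurableType d) (R : realType) (P : probability T R).
Variable X : {RV P >-> R}.

Definition neg_trunc_mean (x : R) : R :=
  fine 'E_P[fun w => Num.min (X^\- w)%R x]%E.
Local Notation m := neg_trunc_mean.

(* The Stieltjes integrator [t / m t] on [(0, +oo)], extended to [(-oo, 0]] by
   its right limit at 0, so that the associated measure puts no mass there.
   If [m] vanishes identically, then so does this function. *)
Definition ratio_fun (t : R) : R :=
  if 0 < t then t / m t else inf [set s / m s | s in `]0, +oo[].

Let Y (x : R) (w : T) : R := Num.min (X^\- w) x.

Let Y_ge0 x : 0 <= x -> forall w, 0 <= Y x w.
Proof. by move=> x0 w; rewrite /Y le_min funrneg_ge0. Qed.

Let mY x : measurable_fun [set: T] (Y x).
Proof.
by apply: measurable_minr => //; apply: measurable_realfun.measurable_funrneg.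
Qed.

Let EY_fin x : 0 <= x -> ('E_P[Y x])%E \is a fin_num.
Proof.
move=> x0; rewrite ge0_fin_numE ?expectation_ge0//; last exact: Y_ge0.
apply: (@le_lt_trans _ _ 'E_P[cst x]%E); last by rewrite expectation_cst ltry.
apply: expectation_le => //; first exact: Y_ge0.
by apply: aeW => w; rewrite /Y ge_min lexx orbT.
Qed.

Let m_ge0 x : 0 <= x -> 0 <= m x.
Proof. by move=> x0; apply/fine_ge0/expectation_ge0; exact: Y_ge0. Qed.

Let m_mono s t : 0 <= s -> s <= t -> m s <= m t.
Proof.
move=> s0 st; have t0 := le_trans s0 st.
apply: fine_le; [exact: EY_fin|exact: EY_fin|].
apply: expectation_le => //; [exact: mY|exact: mY|exact: Y_ge0|exact: Y_ge0|].
by apply: aeW => w; rewrite le_min !ge_min lexx st orbT.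
Qed.

Let m_concave s t : 0 < s -> s <= t -> s * m t <= t * m s.
Proof.
move=> s0 st; have t0 := lt_le_trans s0 st.
have EZ k x : 0 <= k -> 0 <= x -> ('E_P[k \o* Y x] = k%:E * 'E_P[Y x])%E.
  move=> k0 x0; rewrite unlock.
  under eq_integral do rewrite EFinM muleC.
  rewrite ge0_integralZl_EFin//.
  - by move=> w _; rewrite lee_fin Y_ge0.
  - by apply/measurable_EFinP; exact: mY.
have mE k x : 0 <= k -> 0 <= x -> k * m x = fine 'E_P[k \o* Y x]%E.
  by move=> k0 x0; rewrite EZ// fineM// EY_fin.
have [s0' t0'] := (ltW s0, ltW t0).
rewrite !mE//; apply: fine_le.
- by rewrite EZ// fin_numM// EY_fin.
- by rewrite EZ// fin_numM// EY_fin.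
apply: expectation_le => /=.
- by apply: measurable_funM => //; exact: mY.
- by apply: measurable_funM => //; exact: mY.
- by move=> w; rewrite mulr_ge0 ?Y_ge0.
- by move=> w; rewrite mulr_ge0 ?Y_ge0.
apply: aeW => w /=; rewrite /Y; have a0 := funrneg_ge0 X w.
move: (X^\- w) a0 => a a0; rewrite !minr_pMl// le_min !ge_min.
rewrite (mulrC t s) lexx orbT andbT ler_wpM2l//.
Qed.

Let ratio_mono s t : 0 < s -> s <= t -> s / m s <= t / m t.
Proof.
move=> s0 st; have t0 := lt_le_trans s0 st.
have := m_ge0 (ltW s0); rewrite le_eqVlt => /predU1P[ms0|ms0].
  by rewrite -ms0 invr0 mulr0 divr_ge0// ?m_ge0 ?ltW.
have mt0 : 0 < m t by apply: lt_le_trans ms0 _; apply: m_mono => //; exact: ltW.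
by rewrite ler_pdivrMr// mulrAC ler_pdivlMr// m_concave.
Qed.

Let ratio_upper s t : 0 < s -> s <= t -> t / m t <= t / m s.
Proof.
move=> s0 st; have t0 := lt_le_trans s0 st.
have := m_ge0 (ltW s0); rewrite le_eqVlt => /predU1P[ms0|ms0]; last first.
  have mst : m s <= m t by apply: m_mono => //; exact: ltW.
  apply: ler_wpM2l; first exact: ltW.
  by rewrite lef_pV2 ?posrE// (lt_le_trans ms0).
have := m_concave s0 st; rewrite -ms0 mulr0 pmulr_rle0// => mt0.
suff -> : m t = 0 by [].
by apply/eqP; rewrite eq_le mt0 m_ge0// ltW.
Qed.

Let ratio_lb : lbound [set s / m s | s in `]0, +oo[] 0.
Proof.
move=> _ /= [s + <-]; rewrite in_itv/= andbT => s0.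
by rewrite divr_ge0 ?m_ge0 ?ltW.
Qed.

Let inf_ratio_le t : 0 < t -> inf [set s / m s | s in `]0, +oo[] <= t / m t.
Proof.
move=> t0; apply: ge_inf; first by exists 0; exact: ratio_lb.
by exists t => //=; rewrite in_itv/= t0.
Qed.

Let ratio_fun_nd : nondecreasing ratio_fun.
Proof.
move=> s t st; rewrite /ratio_fun; case: ifPn => s0.
  by rewrite (lt_le_trans s0 st) ratio_mono.
by case: ifPn => // t0; exact: inf_ratio_le.
Qed.

Let ratio_fun_rc : right_continuous ratio_fun.
Proof.
move=> x; have [x0|x0|<-] := ltgtP 0 x.
- apply: (@squeeze_cvgr _ _ _ _ (cst (x / m x)) (fun t => t / m x)).
  + near=> t; have xt : x < t by near: t; exact: nbhs_right_gt.
    rewrite /ratio_fun (lt_trans x0 xt)/=; apply/andP; split.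
      by apply: ratio_mono => //; exact: ltW.
    by apply: ratio_upper => //; exact: ltW.
  + by rewrite /ratio_fun x0; exact: cvg_cst.
  + rewrite /ratio_fun x0; apply: cvgMr_tmp; exact: cvg_at_right_filter cvg_id.
- rewrite [X in _ --> X](_ : _ = inf [set s / m s | s in `]0, +oo[]); last first.
    by rewrite /ratio_fun (le_gtF (ltW x0)).
  apply/(@cvgrPdist_le _ R^o) => e e0; near=> t.
  have t0 : t < 0 by near: t; exact: nbhs_right_lt.
  by rewrite /ratio_fun (le_gtF (ltW t0)) subrr normr0 ltW.
- rewrite [X in _ --> X](_ : _ = inf [set s / m s | s in `]0, +oo[]); last first.
    by rewrite /ratio_fun ltxx.
  set I := inf _; apply/(@cvgrPdist_le _ R^o) => e e0.
  have : has_inf [set s / m s | s in `]0, +oo[].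
    split; last by exists 0; exact: ratio_lb.
    by exists (1 / m 1), 1 => //=; rewrite in_itv/= ltr01.
  move=> /(inf_adherent e0)[_ [s + <-]]; rewrite /= in_itv/= andbT => s0 sI.
  near=> t; have t0 : 0 < t by near: t; exact: nbhs_right_gt.
  rewrite /ratio_fun t0 distrC ger0_norm ?subr_ge0 ?inf_ratio_le//.
  rewrite lerBlDl; apply: le_trans (ltW sI); apply: ratio_mono => //.
  by near: t; exact: nbhs_right_le.
Unshelve. all: by end_near. Qed.

HB.instance Definition _ :=
  isCumulative.Build R _ R ratio_fun ratio_fun_nd ratio_fun_rc.

End truncated_mean.

(* Main.v *)
From HB Require Import structures.
Require Import Defs.
From mathcomp Require Import all_boot all_order all_algebra finmap ring lra.
From mathcomp Require Import all_classical all_reals all_analysis.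
From mathcomp Require Import measurable_realfun.
Import Order.TTheory GRing.Theory Num.Theory.
Import numFieldNormedType.Exports.
Local Open Scope classical_set_scope.
Local Open Scope ring_scope.

(** Why the theorem holds. Write [Fbar] for the tail of [F], [M n] for the
    maximum of [S 0, ..., S n], and [I x] for the integral of [Fbar (x + t)]
    against [d (t / m t)], which is [tail G1 x] as soon as it is at most 1.

    The proof counts visits instead of studying ladder heights. Fix a target
    level [x] and follow the depth [x - S n] below it, killing the walk when
    the depth becomes negative. The walk is killed by a single jump, so
    [P (M > x)] is the sum over [n] of the expectation of [Fbar] at the depth
    of the living walk (lemma [hit_jump]). Since [Fbar s] is the mixture of the
    indicators of [s < y] under [F (dy)], only the expected numbers of visits
    to the depths below [L] are needed (lemma [jump_occ]), and these are to be
    compared with [L / m L].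

    Lower bound. A walk started at depth [x] that is never killed must leave
    the depths below [x + t], and then the sum of its steps [min (xi^-, t)] is
    at least [t]. By Wald's identity it spends at least
    [P (M <= x) * t / m t] steps there (lemma [occ_lower]). Integrating in [t]
    gives [P (M > x) >= P (M <= x) * I x] (lemma [itail_le_hit]).

    Upper bound. Until a walk leaves the depths between 0 and [L], the sum of
    [min (xi^-, L) - min (xi^+, L)] is at most [L] before the last step and the
    last step adds at most [L]: by Wald's identity the mean exit time is at
    most [2 L / (m L - E (min (xi^+, L)))] (lemma [green_exit]). This is the
    origin of the factor 2. The integral condition makes the second term of the
    denominator negligible (lemma [pmom_small]). A walk that has gone deeper
    than [L + B] comes back above depth [L] with probability at most
    [P (M > B)] (lemma [occ_bound]), so the number of visits to the depths
    below [L] is asymptotically at most [2 L / m L], uniformly in the starting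
    point. Hence so is the tail of the first overshoot over any level: it is at
    most [(2 + e) * tail G1] (lemma [jump_le_itail]). Finally the path is cut at
    its first passage over a fixed level [A]. The overshoot has total mass
    [P (M > A)], which is small, and after it an independent copy of the walk
    starts. By subexponentiality of [G1], overshoot and new supremum add up to
    a large value because one of them is large; the overshoot contributes
    [(2 + e) * tail G1], the new supremum a small multiple of [tail G1] (lemmas
    [hit_step] and [hit_le_tail]).

    Finiteness of [M] is obtained by the same counting. If [B] is any level
    with [P (M n > B) <= 1/2], the visits are controlled, so that
    [P (M n > 3 B)] is little more than 1/4; and for large [B] a walk started
    at depth [3 B / 4] is deeper than [3 B] before it is killed, with
    probability close to 1. So [P (M n > 3 B / 4) <= 1/2]: such a [B] can be
    lowered to a bound that does not depend on [n] (lemma [hit_half]).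

    Stopping times do not appear: each use of Wald's identity is a
    supersolution or a subsolution of the killed transition operator, checked
    by induction on the number of steps. *)

Set Implicit Arguments.
Unset Strict Implicit.
Unset Printing Implicit Defensive.

(** * Green operators of a killed random walk *)

Section green.
Context (R : realType) (F : probability (measurableTypeR R) R).
Implicit Types (D : set R) (f h : R -> \bar R) (s : R).
Local Open Scope ereal_scope.

(** One step of the walk of depths: a step [y] of the original walk upwards
    lowers the depth [s] to [s - y], and the walk survives inside [D]. *)
Definition step D f s : \bar R := \int[F]_y (f \_ D) (s - y)%R.

(** Expected value of the sum of [f] over the first [n] positions of the walk
    killed outside [D], started at [s]. *)
Fixpoint green D f n s : \bar R :=
  if n is n'.+1 then f s + step D (green D f n') s else 0.

Lemma restr_ge0 D f : (forall s, 0 <= f s) -> forall s, 0 <= (f \_ D) s.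
Proof. by move=> f0 s; rewrite patchE; case: ifP. Qed.

Lemma measurable_restr D f : measurable D -> measurable_fun [set: R] f ->
  measurable_fun [set: R] (f \_ D).
Proof.
move=> mD mf; exact: ((measurable_restrictT f mD).1 (measurable_funTS mf)).
Qed.

Lemma measurable_shift f s : measurable_fun [set: R] f ->
  measurable_fun [set: R] (fun y : R => f (s - y)%R).
Proof. by move=> mf; apply: measurableT_comp => //; exact: measurable_funB. Qed.

Lemma measurable_kill D f s : measurable D -> measurable_fun [set: R] f ->
  measurable_fun [set: R] (fun y : R => (f \_ D) (s - y)%R).
Proof. by move=> mD mf; apply: measurable_shift; exact: measurable_restr. Qed.
Local Hint Resolve measurable_kill restr_ge0 : core.

Lemma step_ge0 D f : (forall s, 0 <= f s) -> forall s, 0 <= step D f s.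
Proof. by move=> f0 s; apply: integral_ge0 => y _; exact: restr_ge0. Qed.

Lemma measurable_step D f : measurable D -> measurable_fun [set: R] f ->
  (forall s, 0 <= f s) -> measurable_fun [set: R] (step D f).
Proof.
move=> mD mf f0.
apply: (measurable_fun_fubini_tonelli_F
  (fun z : measurableTypeR R * measurableTypeR R => (f \_ D) (z.1 - z.2)%R)).
  apply: measurableT_comp; first exact: measurable_restr.
  by apply: measurable_funB; [exact: measurable_fst|exact: measurable_snd].
by move=> z; exact: restr_ge0.
Qed.

Lemma le_step D D' f h s : measurable D -> measurable D' ->
  measurable_fun [set: R] f -> (forall s, 0 <= f s) ->
  measurable_fun [set: R] h -> (forall s, 0 <= h s) -> D `<=` D' ->
  (forall s, D s -> f s <= h s) -> step D f s <= step D' h s.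
Proof.
move=> mD mD' mf f0 mh h0 DD' fh; apply: ge0_le_integral => //.
- by move=> y _; exact: restr_ge0.
- exact: measurable_kill.
- exact: measurable_kill.
move=> y _; rewrite !patchE; case: ifPn => [|_]; last by case: ifP.
by rewrite inE => Dy; rewrite mem_set ?fh//; exact: DD'.
Qed.

Lemma green_ge0 D f n : (forall s, 0 <= f s) -> forall s, 0 <= green D f n s.
Proof.
by move=> f0; elim: n => //= n IH s; rewrite adde_ge0 ?f0//; exact: step_ge0.
Qed.

Lemma measurable_green D f n : measurable D -> measurable_fun [set: R] f ->
  (forall s, 0 <= f s) -> measurable_fun [set: R] (green D f n).
Proof.
move=> mD mf f0; elim: n => /= [|n IH]; first exact: measurable_cst.
apply: emeasurable_funD => //; apply: measurable_step => //.
exact: green_ge0.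
Qed.

Lemma le_green D D' f h n s : measurable D -> measurable D' ->
  measurable_fun [set: R] f -> (forall s, 0 <= f s) ->
  measurable_fun [set: R] h -> (forall s, 0 <= h s) -> D `<=` D' ->
  (forall s, f s <= h s) -> green D f n s <= green D' h n s.
Proof.
move=> mD mD' mf f0 mh h0 DD' fh; elim: n s => //= n IH s.
apply: leeD => //; apply: le_step => //.
- exact: measurable_green.
- exact: green_ge0.
- exact: measurable_green.
- exact: green_ge0.
Qed.

(** Induction on [n] replaces optional stopping: a nonnegative supersolution
    dominates all finite-horizon sums. *)
Lemma green_super D f h n s : measurable D ->
  measurable_fun [set: R] f -> (forall s, 0 <= f s) ->
  measurable_fun [set: R] h -> (forall s, 0 <= h s) ->
  (forall s, D s -> f s + step D h s <= h s) -> D s -> green D f n s <= h s.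
Proof.
move=> mD mf f0 mh h0 fh; elim: n s => [|n IH] s Ds //=.
apply: le_trans (fh s Ds); apply: leeD => //; apply: le_step => //.
- exact: measurable_green.
- exact: green_ge0.
Qed.

Lemma stepD D f h s : measurable D ->
  measurable_fun [set: R] f -> (forall s, 0 <= f s) ->
  measurable_fun [set: R] h -> (forall s, 0 <= h s) ->
  step D (fun s => f s + h s) s = step D f s + step D h s.
Proof.
move=> mD mf f0 mh h0; rewrite /step -ge0_integralD//=.
- apply: eq_integral => y _; rewrite !patchE; case: ifP => //.
  by rewrite adde0.
- by move=> y _; exact: restr_ge0.
- exact: measurable_kill.
- by move=> y _; exact: restr_ge0.
- exact: measurable_kill.
Qed.

Lemma stepZ D f (k : R) s : measurable D ->
  measurable_fun [set: R] f -> (forall s, 0 <= f s) -> (0 <= k)%R ->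
  step D (fun s => k%:E * f s) s = k%:E * step D f s.
Proof.
move=> mD mf f0 k0; rewrite /step -ge0_integralZl//=.
- by apply: eq_integral => y _; rewrite !patchE; case: ifP => //; rewrite mule0.
- exact: measurable_kill.
- by move=> y _; exact: restr_ge0.
Qed.

Lemma greenD D f h n s : measurable D ->
  measurable_fun [set: R] f -> (forall s, 0 <= f s) ->
  measurable_fun [set: R] h -> (forall s, 0 <= h s) ->
  green D (fun s => f s + h s) n s = green D f n s + green D h n s.
Proof.
move=> mD mf f0 mh h0; elim: n s => [|n IH] s /=; first by rewrite adde0.
rewrite (_ : green D _ n = fun s => green D f n s + green D h n s); last first.
  by apply/funext.
rewrite stepD//.
- by rewrite addeACA.
- exact: measurable_green.
- exact: green_ge0.
- exact: measurable_green.
- exact: green_ge0.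
Qed.

Lemma greenZ D f (k : R) n s : measurable D ->
  measurable_fun [set: R] f -> (forall s, 0 <= f s) -> (0 <= k)%R ->
  green D (fun s => k%:E * f s) n s = k%:E * green D f n s.
Proof.
move=> mD mf f0 k0; elim: n s => [|n IH] s /=; first by rewrite mule0.
rewrite (_ : green D _ n = fun s => k%:E * green D f n s); last by apply/funext.
rewrite stepZ//; last 2 first.
- exact: measurable_green.
- exact: green_ge0.
by rewrite [in RHS]ge0_muleDr//; apply: step_ge0; exact: green_ge0.
Qed.

End green.

Section mixture.
Context (R : realType) (F : probability (measurableTypeR R) R).
Context d (T : measurableType d).
Local Open Scope ereal_scope.

Lemma measurable_kill2 dX (X : measurableType dX) (D : set R)
    (g : R -> T -> \bar R) (u : X -> R) (v : X -> T) : measurable D ->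
  measurable_fun setT (fun z : measurableTypeR R * T => g z.1 z.2) ->
  measurable_fun setT u -> measurable_fun setT v ->
  measurable_fun setT (fun w => ((g ^~ (v w)) \_ D) (u w)).
Proof.
move=> mD mg mu mv; pose E : set (measurableTypeR R * T) := D `*` setT.
have mE : measurable E by exact: measurableX.
pose g' (z : measurableTypeR R * T) := g z.1 z.2.
rewrite (_ : (fun w => _) = (g' \_ E) \o (fun w => (u w, v w))); last first.
  apply/funext => w /=; rewrite !patchE.
  rewrite (_ : (_ \in E) = (u w \in D))//.
  by apply/idP/idP; rewrite !inE /E//= => -[].
apply: measurableT_comp.
  exact: ((measurable_restrictT g' mE).1 (measurable_funTS mg)).
by apply/measurable_fun_pairP; split.
Qed.

Variables (mu : {sigma_finite_measure set T -> \bar R}) (D : set R).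
Variables (f : R -> T -> \bar R).
Hypotheses (mD : measurable D) (f0 : forall s t, (0 <= f s t)%E).
Hypothesis mf : measurable_fun setT (fun z : measurableTypeR R * T => f z.1 z.2).

Lemma measurable_green2 n : measurable_fun setT
  (fun z : measurableTypeR R * T => green F D (f ^~ z.2) n z.1).
Proof.
elim: n => [|n IH] /=; first exact: measurable_cst.
apply: emeasurable_funD => //; rewrite /step.
apply: (measurable_fun_fubini_tonelli_F (fun w :
  (measurableTypeR R * T)%type * measurableTypeR R =>
  (green F D (f ^~ w.1.2) n \_ D) (w.1.1 - w.2)%R)); last first.
  by move=> w; apply: restr_ge0 => s; exact: green_ge0.
apply: (measurable_kill2 (g := fun s t => green F D (f ^~ t) n s)) => //.
  apply: measurable_funB; last exact: measurable_snd.
  by apply: measurableT_comp; [exact: measurable_fst|exact: measurable_fst].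
by apply: measurableT_comp; [exact: measurable_snd|exact: measurable_fst].
Qed.

Lemma measurable_section s : measurable_fun [set: T] (f s).
Proof. exact: measurableT_comp mf (pair1_measurable s). Qed.

(** Tonelli's theorem at each step. It reduces sources that are mixtures of
    indicators to counting visits. *)
Lemma green_mix n s : green F D (fun s => \int[mu]_t f s t) n s =
  \int[mu]_t green F D (f ^~ t) n s.
Proof.
have g0 k t s' : 0 <= green F D (f ^~ t) k s' by exact: green_ge0.
elim: n s => [|n IH] s; first by rewrite /= integral0.
pose h (w : measurableTypeR R * T) := (green F D (f ^~ w.2) n \_ D) (s - w.1)%R.
have mh : measurable_fun setT h.
  apply: (measurable_kill2 (g := fun s t => green F D (f ^~ t) n s)) => //.
    exact: measurable_green2.
  by apply: measurable_funB; [exact: measurable_cst|exact: measurable_fst].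
have h0 w : 0 <= h w by exact: restr_ge0.
have fE : step F D (green F D (fun s => \int[mu]_t f s t) n) s =
    \int[mu]_t step F D (green F D (f ^~ t) n) s.
  rewrite /step -(fubini_tonelli h)//; apply: eq_integral => y _.
  rewrite /h /= patchE; case: ifPn => yD; last first.
    by rewrite integral0_eq// => t _; rewrite patchE (negbTE yD).
  by rewrite IH; apply: eq_integral => t _; rewrite patchE yD.
rewrite [LHS]/= fE -ge0_integralD//.
- exact: measurable_section.
- by move=> t _; apply: step_ge0.
- exact: (measurable_fun_fubini_tonelli_G h).
Qed.
End mixture.

(** * First passage, occupation and overshoot *)

Lemma measurable_ltb d (T : measurableType d) (R : realType) (u v : T -> R) :
  measurable_fun setT u -> measurable_fun setT v ->
  measurable_fun setT (fun w => (u w < v w)%R%:R%:E : \bar R).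
Proof.
move=> mu mv.
rewrite (_ : (fun _ => _) = fun w => if (u w < v w)%R then 1%E else 0%E).
  by apply: measurable_fun_ifT => //; exact: measurable_fun_ltr.
by apply/funext => w; case: ifP.
Qed.

Section hit.
Context (R : realType) (F : probability (measurableTypeR R) R).
Local Open Scope ereal_scope.

(** The probability that the maximum of the first [n] partial sums exceeds [s],
    in the form of its first-step recursion; the link with the actual walk is
    [runmax_hit]. *)
Fixpoint hit n (s : R) : \bar R :=
  if (s < 0)%R then 1 else
  if n is n'.+1 then \int[F]_y hit n' (s - y)%R else 0.

Lemma hit_lt0 n s : (s < 0)%R -> hit n s = 1.
Proof. by case: n => [|n] /= ->. Qed.

Lemma hitS n s : (0 <= s)%R -> hit n.+1 s = \int[F]_y hit n (s - y)%R.
Proof. by move=> s0 /=; rewrite ltNge s0. Qed.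

Lemma hit_ge0 n s : 0 <= hit n s.
Proof.
by elim: n s => [|n IH] s /=; case: ifPn => // _; apply: integral_ge0 => y _.
Qed.

Lemma integral_probc (c : R) : \int[F]_y (cst c%:E y) = c%:E.
Proof.
rewrite integral_cst// -[RHS]mule1; congr (_ * _); exact: probability_setT.
Qed.

Lemma measurable_hit n : measurable_fun [set: R] (hit n).
Proof.
have mlt0 : measurable_fun [set: R] (fun s : R => (s < 0)%R).
  by apply: measurable_fun_ltr.
elim: n => [|n IH] /=; apply: measurable_fun_ifT => //.
apply: (measurable_fun_fubini_tonelli_F
  (fun z : measurableTypeR R * measurableTypeR R => hit n (z.1 - z.2)%R)).
  apply: measurableT_comp => //.
  by apply: measurable_funB; [exact: measurable_fst|exact: measurable_snd].
by move=> z; exact: hit_ge0.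
Qed.

Lemma measurable_hit_shift n s : measurable_fun [set: R] (fun y : R => hit n (s - y)%R).
Proof. exact: measurable_shift (measurable_hit n). Qed.

Lemma hit_le1 n s : hit n s <= 1.
Proof.
elim: n s => [|n IH] s; have [s0|s0] := ltP s 0%R; try by rewrite hit_lt0.
  by rewrite /= ltNge s0/= lee01.
rewrite hitS// -(integral_probc 1); apply: ge0_le_integral => //.
- by move=> y _; exact: hit_ge0.
- exact: measurable_hit_shift.
Qed.

Lemma le_hit n s s' : (s <= s')%R -> hit n s' <= hit n s.
Proof.
elim: n s s' => [|n IH] s s' ss'; have [s0|s0] := ltP s 0%R.
- by rewrite [leRHS]hit_lt0// hit_le1.
- by rewrite /= [(s' < 0)%R]ltNge (le_trans s0 ss')//= ltNge s0.
- by rewrite [leRHS]hit_lt0// hit_le1.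
rewrite !hitS//; last exact: le_trans ss'.
apply: ge0_le_integral => //.
- by move=> y _; exact: hit_ge0.
- exact: measurable_hit_shift.
- exact: measurable_hit_shift.
- by move=> y _; apply: IH; rewrite lerD2r.
Qed.

Lemma hit_nd m n s : (m <= n)%N -> hit m s <= hit n s.
Proof.
elim: m n s => [|m IH] n s mn; have [s0|s0] := ltP s 0%R;
  try by rewrite !hit_lt0.
  by rewrite [leLHS]/= ltNge s0/= hit_ge0.
case: n mn => // n mn; rewrite !hitS//; apply: ge0_le_integral => //.
- by move=> y _; exact: hit_ge0.
- exact: measurable_hit_shift.
- exact: measurable_hit_shift.
- by move=> y _; exact: IH.
Qed.

(** From depth [s], the next step kills the walk with an overshoot larger
    than [z]. *)
Definition exceed (z s : R) : \bar R := F `](s + z)%R, +oo[%classic.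

(** The indicator is not cut at 0, so that the identity [exceed_below] holds at
    every point; killing at negative depths does the cut. *)
Definition below (L : R) : R -> \bar R := EFin \o \1_(`]-oo, L[%classic).

Lemma belowE L s : below L s = (s < L)%R%:R%:E.
Proof.
rewrite /below /= indicE; have -> // : (s \in `]-oo, L[%classic) = (s < L)%R.
by apply/idP/idP; rewrite inE/= in_itv.
Qed.

Lemma exceed_below z s : exceed z s = \int[F]_y below (y - z) s.
Proof.
under eq_integral do rewrite belowE ltrBrDr.
rewrite /exceed -[X in F X]setIT -integral_indic//; apply: eq_integral => y _ /=.
rewrite indicE; have -> // : (y \in `](s + z)%R, +oo[%classic) = (s + z < y)%R.
by apply/idP/idP; rewrite inE/= in_itv/= andbT.
Qed.

Lemma exceed_ge0 z s : 0 <= exceed z s. Proof. exact: measure_ge0. Qed.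

Lemma below_ge0 L s : 0 <= below L s.
Proof. by rewrite belowE lee_fin. Qed.

Lemma measurable_below L : measurable_fun [set: R] (below L).
Proof. by apply/measurable_EFinP; exact: measurable_indic. Qed.

Lemma measurable_below2 z : measurable_fun setT
  (fun w : measurableTypeR R * measurableTypeR R => below (w.2 - z)%R w.1).
Proof.
rewrite (_ : (fun _ => _) = fun w : measurableTypeR R * measurableTypeR R =>
    (w.1 + z < w.2)%R%:R%:E); last first.
  by apply/funext => w /=; rewrite belowE ltrBrDr.
apply: measurable_ltb; last exact: measurable_snd.
apply: measurable_funD; [exact: measurable_fst|exact: measurable_cst].
Qed.

Lemma measurable_below_shift z s :
  measurable_fun [set: R] (fun y => below (y - z)%R s).
Proof. exact: measurableT_comp (measurable_below2 z) (pair1_measurable s). Qed.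

Lemma measurable_exceed z : measurable_fun [set: R] (exceed z).
Proof.
rewrite (_ : exceed z = fun s => \int[F]_y below (y - z) s); last first.
  by apply/funext => s; rewrite exceed_below.
apply: (measurable_fun_fubini_tonelli_F
  (fun w : measurableTypeR R * measurableTypeR R => below (w.2 - z)%R w.1)).
  exact: measurable_below2.
by move=> w; exact: below_ge0.
Qed.

Definition alive : set R := `[0%R, +oo[%classic.

Lemma mem_alive s : (s \in alive) = (0 <= s)%R.
Proof. by apply/idP/idP; rewrite inE /alive/= in_itv/= andbT. Qed.

Lemma measurable_alive : measurable alive. Proof. exact: measurable_itv. Qed.

(** [occ] counts the visits to the depths below [L], and [jump] is the
    probability that the first passage over the target level happens within [n]
    steps with an overshoot larger than [z]. *)
Definition occ L n s := green F alive (below L) n s.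
Definition jump z n s := green F alive (exceed z) n s.

(** All that has to be known about first passages is the number of visits. *)
Lemma jump_occ z n s : jump z n s = \int[F]_y occ (y - z) n s.
Proof.
rewrite /jump (_ : exceed z = fun s => \int[F]_y below (y - z) s); last first.
  by apply/funext => s'; rewrite exceed_below.
apply: (@green_mix _ F _ _ F alive (fun s y => below (y - z) s)) => //.
- exact: measurable_alive.
- by move=> *; exact: below_ge0.
- exact: measurable_below2.
Qed.

Lemma hit_jump n s : (0 <= s)%R -> hit n s = jump 0 n s.
Proof.
elim: n s => [|n IH] s s0; first by rewrite /= ltNge s0.
rewrite hitS// /jump /= exceed_below /step -ge0_integralD//=.
- apply: eq_integral => y _; rewrite patchE mem_alive belowE subr0.
  have [sy|ys] := ltP s y; rewrite subr_ge0.
    by rewrite leNgt sy/= hit_lt0 ?subr_lt0// adde0.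
  by rewrite ys IH ?subr_ge0// add0e.
- by move=> y _; exact: below_ge0.
- exact: measurable_below_shift.
- move=> y _; apply: restr_ge0 => ?; apply: green_ge0 => ?; exact: exceed_ge0.
- apply: measurable_kill; first exact: measurable_alive.
  apply: measurable_green; [exact: measurable_alive|exact: measurable_exceed|].
  by move=> *; exact: exceed_ge0.
Qed.

Lemma occ_ge0 L n s : 0 <= occ L n s.
Proof. by apply: green_ge0 => ?; exact: below_ge0. Qed.

Lemma measurable_occ L n : measurable_fun [set: R] (occ L n).
Proof.
apply: measurable_green; [exact: measurable_alive|exact: measurable_below|].
by move=> *; exact: below_ge0.
Qed.

Lemma measurable_occ_shift z n s :
  measurable_fun [set: R] (fun y => occ (y - z)%R n s).
Proof.
have := @measurable_green2 _ F _ (measurableTypeR R) _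
  (fun s y => below (y - z)%R s) (@measurable_alive) (fun _ _ => below_ge0 _ _) (measurable_below2 z) n.
by move=> mg; exact: measurableT_comp mg (pair1_measurable s).
Qed.

Lemma measurable_jump n s : measurable_fun [set: R] (fun z => jump z n s).
Proof.
have me2 : measurable_fun setT
    (fun w : measurableTypeR R * measurableTypeR R => exceed w.2 w.1).
  rewrite (_ : (fun _ => _) = exceed 0 \o (fun w => (w.1 + w.2)%R)); last first.
    by apply/funext => w; rewrite /exceed /= addr0.
  apply: measurableT_comp; first exact: measurable_exceed.
  by apply: measurable_funD; [exact: measurable_fst|exact: measurable_snd].
have := @measurable_green2 _ F _ (measurableTypeR R) _ (fun s z => exceed z s)
  (@measurable_alive) (fun _ _ => exceed_ge0 _ _) me2 n.
by move=> mg; exact: measurableT_comp mg (pair1_measurable s).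
Qed.

Lemma jump_ge0 z n s : 0 <= jump z n s.
Proof. by apply: green_ge0 => ?; exact: exceed_ge0. Qed.

Lemma le_occ L L' n s : (L <= L')%R -> occ L n s <= occ L' n s.
Proof.
move=> LL'; apply: le_green => //; try exact: measurable_alive;
  try exact: measurable_below; try by move=> *; exact: below_ge0.
move=> s'; rewrite !belowE lee_fin ler_nat.
by case: ltP => // sL; rewrite (lt_le_trans sL).
Qed.

Lemma le_jump z z' n s : (z <= z')%R -> jump z' n s <= jump z n s.
Proof.
move=> zz'; apply: le_green => //; try exact: measurable_alive;
  try exact: measurable_exceed; try by move=> *; exact: exceed_ge0.
move=> s'; apply: le_measure; rewrite ?inE//=.
by apply: subset_itvr; rewrite bnd_simp lerD2l.
Qed.

Lemma jump_le_hit z n s : (0 <= z)%R -> (0 <= s)%R -> jump z n s <= hit n s.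
Proof. by move=> z0 s0; rewrite hit_jump// le_jump. Qed.

Lemma occ_le0 L n s : (L <= 0)%R -> (0 <= s)%R -> occ L n s = 0.
Proof.
move=> L0 s0; apply/eqP; rewrite eq_le occ_ge0 andbT.
apply: (green_super (h := cst 0)) => //.
- exact: measurable_alive.
- exact: measurable_below.
- by move=> ?; exact: below_ge0.
- move=> s'; rewrite /alive/= in_itv/= andbT => s'0.
  rewrite belowE ltNge (le_trans L0 s'0) /= add0e /step integral0_eq//.
  by move=> y _; rewrite patchE; case: ifP.
- by rewrite /alive/= in_itv/= s0.
Qed.

End hit.
Arguments alive {R}.

(** * Truncated moments and upper bounds for exit times *)

Section moments.
Context (R : realType) (F : probability (measurableTypeR R) R).

Definition npart (L y : R) : R := Num.min (Num.max (- y) 0) L.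
Definition ppart (L y : R) : R := Num.min (Num.max y 0) L.

Lemma npart_ge0 L y : 0 <= L -> 0 <= npart L y.
Proof. by move=> L0; rewrite /npart le_min le_max lexx orbT. Qed.

Lemma ppart_ge0 L y : 0 <= L -> 0 <= ppart L y.
Proof. by move=> L0; rewrite /ppart le_min le_max lexx orbT. Qed.

Lemma npart_le L y : npart L y <= L.
Proof. by rewrite /npart ge_min lexx orbT. Qed.

Lemma ppart_le L y : ppart L y <= L.
Proof. by rewrite /ppart ge_min lexx orbT. Qed.

Lemma le_npart L s y : s <= - y -> s <= L -> s <= npart L y.
Proof. by move=> sy sL; rewrite /npart le_min sL le_max sy. Qed.

Lemma le_ppart L s y : s <= y -> s <= L -> s <= ppart L y.
Proof. by move=> sy sL; rewrite /ppart le_min sL le_max sy. Qed.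

Lemma npart_eq0 L y : 0 <= L -> 0 <= y -> npart L y = 0.
Proof. by move=> L0 y0; rewrite /npart max_r ?oppr_le0// min_l. Qed.

Lemma ppart_le_max L y : ppart L y <= Num.max y 0.
Proof. by rewrite /ppart ge_min lexx. Qed.

Lemma ppartB L y : - L <= y <= L -> ppart L y - npart L y = y.
Proof.
move=> yL; rewrite /ppart /npart; have [y0|y0] := orP (le_total 0 y).
  rewrite max_l// min_l; last by lra.
  by rewrite max_r ?oppr_le0// min_l ?subr0//; lra.
rewrite max_r// min_l; last by lra.
rewrite max_l; last by lra.
by rewrite min_l ?sub0r ?opprK//; lra.
Qed.

Lemma min_le_npart t y v : 0 <= t -> 0 <= v + y ->
  Num.min v t <= npart t y + Num.min (v + y) t.
Proof.
move=> t0 vy; have n0 := npart_ge0 y t0.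
have [yt|ty] := leP (- y) t; last first.
  have nt := le_npart (ltW ty) (lexx t).
  have : 0 <= Num.min (v + y) t by rewrite le_min vy.
  by rewrite ge_min => ?; apply/orP; right; lra.
have ny := le_npart (lexx (- y)) yt.
rewrite -lerBlDl le_min; apply/andP; split.
  by rewrite lerBlDl ge_min; apply/orP; left; lra.
by rewrite lerBlDl ge_min; apply/orP; right; lra.
Qed.

Lemma measurable_npart L : measurable_fun [set: R] (npart L).
Proof.
apply: measurable_minr => //; apply: measurable_maxr => //.
Qed.

Lemma measurable_ppart L : measurable_fun [set: R] (ppart L).
Proof. by apply: measurable_minr => //; apply: measurable_maxr. Qed.

Definition nmom L : R := fine (\int[F]_y (npart L y)%:E).
Definition pmom L : R := fine (\int[F]_y (ppart L y)%:E).

Let mom_fin (L : R) (p : R -> R) : measurable_fun [set: R] p ->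
  (forall y, 0 <= p y <= L) -> (\int[F]_y (p y)%:E)%E \is a fin_num.
Proof.
move=> mp pL; rewrite ge0_fin_numE; last first.
  by apply: integral_ge0 => y _; rewrite lee_fin; have /andP[] := pL y.
apply: (@le_lt_trans _ _ L%:E); last exact: ltry.
rewrite -(integral_probc F L); apply: ge0_le_integral => //.
- by move=> y _; rewrite lee_fin; have /andP[] := pL y.
- exact/measurable_EFinP.
- by move=> y _; rewrite lee_fin; have /andP[] := pL y.
Qed.

Lemma nmomE L : 0 <= L -> (\int[F]_y (npart L y)%:E)%E = (nmom L)%:E.
Proof.
move=> L0; rewrite /nmom fineK// (@mom_fin L)//; first exact: measurable_npart.
by move=> y; rewrite npart_ge0//= npart_le.
Qed.

Lemma pmomE L : 0 <= L -> (\int[F]_y (ppart L y)%:E)%E = (pmom L)%:E.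
Proof.
move=> L0; rewrite /pmom fineK// (@mom_fin L)//; first exact: measurable_ppart.
by move=> y; rewrite ppart_ge0//= ppart_le.
Qed.

Lemma nmom_ge0 L : 0 <= L -> 0 <= nmom L.
Proof.
by move=> L0; apply/fine_ge0/integral_ge0 => y _; rewrite lee_fin npart_ge0.
Qed.

Lemma pmom_ge0 L : 0 <= L -> 0 <= pmom L.
Proof.
by move=> L0; apply/fine_ge0/integral_ge0 => y _; rewrite lee_fin ppart_ge0.
Qed.

Local Open Scope ereal_scope.

(** Integrated form of the pointwise checks below: [k] and [l] are the weights
    with which the truncated downward and upward steps enter a drift
    condition. *)
Lemma le_drift (phi : R -> \bar R) (k l L v : R) :
  measurable_fun [set: R] phi -> (forall y, 0 <= phi y) ->
  (0 <= k)%R -> (0 <= l)%R -> (0 <= L)%R -> (0 <= v)%R ->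
  (forall y, phi y + (k * npart L y)%:E <= v%:E + (l * ppart L y)%:E) ->
  \int[F]_y phi y <= (v + l * pmom L - k * nmom L)%:E.
Proof.
move=> mphi phi0 k0 l0 L0 v0 phiL.
have mn : measurable_fun [set: R] (EFin \o npart L).
  by apply/measurable_EFinP; exact: measurable_npart.
have mp : measurable_fun [set: R] (EFin \o ppart L).
  by apply/measurable_EFinP; exact: measurable_ppart.
have n0 y : 0 <= (npart L y)%:E by rewrite lee_fin npart_ge0.
have p0 y : 0 <= (ppart L y)%:E by rewrite lee_fin ppart_ge0.
have kn0 y : 0 <= k%:E * (npart L y)%:E by rewrite mule_ge0// lee_fin.
have lp0 y : 0 <= l%:E * (ppart L y)%:E by rewrite mule_ge0// lee_fin.
have mkn : measurable_fun [set: R] (fun y => k%:E * (npart L y)%:E).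
  exact: measurable_funeM.
have mlp : measurable_fun [set: R] (fun y => l%:E * (ppart L y)%:E).
  exact: measurable_funeM.
have v0' : 0 <= v%:E by rewrite lee_fin.
rewrite EFinB leeBrDr// EFinD !EFinM -nmomE// -pmomE//.
rewrite -[X in _ <= X + _](integral_probc F v).
rewrite -!ge0_integralZl// -!ge0_integralD//.
apply: ge0_le_integral => //.
- by move=> y _; rewrite adde_ge0.
- exact: emeasurable_funD.
- exact: emeasurable_funD.
Qed.

Lemma measurable_restr_EFin (D : set R) (h : R -> R) : measurable D ->
  measurable_fun [set: R] h -> measurable_fun [set: R] ((EFin \o h) \_ D).
Proof. by move=> mD mh; apply: measurable_restr => //; exact/measurable_EFinP. Qed.

Lemma mem_itvcc (a b s : R) : (s \in `[a, b]%classic) = (a <= s <= b)%R.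
Proof. by apply/idP/idP; rewrite inE/= in_itv. Qed.

Lemma mem_itvco (a b s : R) : (s \in `[a, b[%classic) = (a <= s < b)%R.
Proof. by apply/idP/idP; rewrite inE/= in_itv. Qed.

(** Wald's bound. The function [2 L - s] loses at least the truncated step
    [npart L y - ppart L y] at each step: exactly that much while the walk stays
    between 0 and [L], and at least [L] when it leaves. *)
Lemma green_exit L n s : (0 < L)%R -> (pmom L < nmom L)%R -> (0 <= s <= L)%R ->
  green F `[0%R, L]%classic (cst 1) n s <= (2 * L / (nmom L - pmom L))%:E.
Proof.
move=> L0 pn sL; set c := (nmom L - pmom L)%R.
have c0 : (0 < c)%R by rewrite subr_gt0.
set D := `[0%R, L]%classic; have mD : measurable D by exact: measurable_itv.
pose h := (EFin \o (fun s => (2 * L - s) / c)%R) \_ D.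
have hE s' : (0 <= s' <= L)%R -> h s' = ((2 * L - s') / c)%:E.
  by move=> s'L; rewrite /h patchE mem_itvcc s'L.
have h0 s' : 0 <= h s'.
  rewrite /h patchE mem_itvcc; case: ifP => // s'L /=.
  by rewrite lee_fin divr_ge0 ?ltW//; lra.
have mh : measurable_fun [set: R] h.
  apply: measurable_restr_EFin => //; apply: measurable_funM => //.
  exact: measurable_funB.
apply: (@le_trans _ _ (h s)); last first.
  by rewrite hE// lee_fin ler_pM2r ?invr_gt0//; lra.
apply: green_super => //.
move=> {sL}s; rewrite /D/= in_itv/= => sL.
have : step F D h s <= ((2 * L - s) / c + c^-1 * pmom L - c^-1 * nmom L)%:E.
  apply: le_drift.
  - exact: measurable_kill.
  - by move=> y; exact: restr_ge0.
  - by rewrite invr_ge0 ltW.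
  - by rewrite invr_ge0 ltW.
  - exact: ltW.
  - by rewrite divr_ge0 ?ltW//; lra.
  move=> y; rewrite patchE mem_itvcc; case: ifPn => syL.
    rewrite hE// -!EFinD lee_fin ![(c^-1 * _)%R]mulrC -!mulrDl.
    rewrite ler_pM2r ?invr_gt0//.
    have yL : (- L <= y <= L)%R by move: sL syL; clear; lra.
    by have := ppartB yL; lra.
  rewrite add0e -EFinD lee_fin ![(c^-1 * _)%R]mulrC -!mulrDl.
  rewrite ler_pM2r ?invr_gt0//.
  by have := npart_le L y; have := ppart_ge0 y (ltW L0); lra.
rewrite hE// => /(leeD2l 1) /le_trans; apply.
rewrite -EFinD lee_fin.
have : (c^-1 * (nmom L - pmom L) = 1)%R by rewrite mulVf// gt_eqF.
by rewrite mulrBr; lra.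
Qed.

(** Starting at depth [b], the walk is killed before it gets deeper than [L]
    only if its upward steps, truncated at [L], add up to [b]; their mean total
    is [pmom F L] times the mean exit time. The supersolution is
    [1 - s / b], corrected by the multiple [k] of [2 L - s] that pays for the
    upward steps. *)
Lemma hit_exit_up (b L : R) N : (0 < b <= L)%R -> (pmom L < nmom L)%R ->
  hit F N b <= (2 * L / b * (pmom L / (nmom L - pmom L)))%:E + hit F N L.
Proof.
move=> /andP[b0 bL] pn; have L0 := lt_le_trans b0 bL.
set c := (nmom L - pmom L)%R; have c0 : (0 < c)%R by rewrite subr_gt0.
pose k := ((pmom L / c) / b)%R.
have k0 : (0 <= k)%R by rewrite !divr_ge0 ?pmom_ge0 ?ltW.
have [g gE] : exists g, hit F N L = g%:E.
  by exists (fine (hit F N L)); rewrite fineK// ge0_fin_numE ?hit_ge0// (le_lt_trans (hit_le1 _ _ _))// ltry.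
have g0 : (0 <= g)%R by rewrite -lee_fin -gE hit_ge0.
pose psi s := (Num.max (1 - s / b) 0 + k * (2 * L - s) + g)%R.
have mx0 (x : R) : (0 <= Num.max x 0)%R by rewrite le_max lexx orbT.
suff H n (s : R) : (n <= N)%N -> (0 <= s <= L)%R -> hit F n s <= (psi s)%:E.
  apply: (le_trans (H N b (leqnn _) _)); first by lra.
  rewrite gE -EFinD lee_fin /psi divff ?gt_eqF// subrr maxxx add0r lerD2r.
  rewrite (_ : 2 * L / b * _ = k * (2 * L))%R; last by rewrite /k; ring.
  by rewrite ler_wpM2l//; lra.
have psi0 (s' : R) : (0 <= s' <= L)%R -> (0 <= psi s')%R.
  by move=> s'L; rewrite /psi !addr_ge0// mulr_ge0//; lra.
elim: n s => [|n IH] s nN sL.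
  by have /andP[s0 _] := sL; rewrite /= ltNge s0/= lee_fin psi0.
have s0 : (0 <= s)%R by case/andP: sL.
rewrite hitS//.
have -> : psi s = (psi s + (k + b^-1) * pmom L - k * nmom L)%R.
  have : (k * c = pmom L / b)%R by rewrite /k; field; rewrite !gt_eqF.
  by rewrite /c mulrBr mulrDl [(pmom L / b)%R]mulrC; lra.
have i0 : (0 <= b^-1)%R by rewrite invr_ge0 ltW.
have ki0 : (0 <= k + b^-1)%R by exact: addr_ge0.
apply: le_drift => //; [exact: measurable_hit_shift|
  by move=> y; exact: hit_ge0|exact: ltW|exact: psi0|].
move=> y; have n0 := npart_ge0 y (ltW L0); have p0 := ppart_ge0 y (ltW L0).
have nL := npart_le L y.
have [sy|ys] := ltP s y.
  rewrite hit_lt0 ?subr_lt0// -!EFinD lee_fin.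
  have -> : npart L y = 0%R.
    by rewrite npart_eq0// ?(ltW L0)// (le_trans s0)// ltW.
  have : (b^-1 * s <= b^-1 * ppart L y)%R.
    by rewrite ler_wpM2l// le_ppart ?(ltW sy)//; case/andP: sL.
  have : (1 - s / b <= Num.max (1 - s / b) 0)%R by rewrite le_max lexx.
  have : (0 <= k * (2 * L - s))%R by rewrite mulr_ge0//; lra.
  have : (0 <= k * ppart L y)%R by rewrite mulr_ge0.
  by rewrite /psi; lra.
have [syL|Lsy] := leP (s - y)%R L.
  apply: le_trans (leeD2r _ (IH (s - y)%R _ _)) _ => //.
  - exact: ltnW.
  - by rewrite subr_ge0 ys.
  rewrite -!EFinD lee_fin.
  have yL : (- L <= y <= L)%R by apply/andP; split; lra.
  have ppE := ppartB yL.
  have /(ler_wpM2l k0) : (y + npart L y <= ppart L y)%R by lra.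
  have /(ler_wpM2l i0) iy : (y <= ppart L y)%R by rewrite le_ppart//; lra.
  have : (Num.max (1 - (s - y) / b) 0 <= Num.max (1 - s / b) 0 + b^-1 * ppart L y)%R.
    rewrite ge_max; apply/andP; split; last by rewrite addr_ge0// mulr_ge0.
    have : (1 - s / b <= Num.max (1 - s / b) 0)%R by rewrite le_max lexx.
    by lra.
  by rewrite /psi; lra.
have : hit F n (s - y) <= g%:E.
  by rewrite -gE; apply: le_trans (hit_nd F _ (ltnW nN)) _; rewrite le_hit// ltW.
move=> /(leeD2r (k * npart L y)%:E)/le_trans; apply.
rewrite -!EFinD lee_fin.
have /(ler_wpM2l k0) : (npart L y <= 2 * L - s)%R by lra.
have : (0 <= Num.max (1 - s / b) 0)%R by [].
have : (0 <= (k + b^-1) * ppart L y)%R by rewrite mulr_ge0// addr_ge0.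
by rewrite /psi; lra.
Qed.

End moments.

Section occupation.
Context (R : realType) (F : probability (measurableTypeR R) R).
Local Open Scope ereal_scope.

(** A walk deeper than [L + B] returns to the depths below [L] with probability
    at most [dl], and each return is followed by at most [W] visits, where
    [W = e + dl * W] is the resulting bound. The three inequalities have to be
    proved together, by induction on the horizon. *)
Lemma occ_bound (L B e dl : R) N : (0 < L)%R -> (0 <= B)%R -> (0 <= dl < 1)%R ->
  (0 <= e)%R -> hit F N B <= dl%:E ->
  (forall n s, (0 <= s <= L + B)%R ->
     green F `[0%R, (L + B)%R]%classic (cst 1) n s <= e%:E) ->
  forall s, (0 <= s)%R -> occ F L N s <= (e / (1 - dl))%:E.
Proof.
move=> L0 B0 /andP[dl0 dl1] e0 hB He.
set D := `[0%R, (L + B)%R]%classic; have mD : measurable D by exact: measurable_itv.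
pose W := (e / (1 - dl))%R; have W0 : (0 <= W)%R by rewrite divr_ge0// subr_ge0 ltW.
have WE : (e + dl * W = W)%R by rewrite /W; field; rewrite gt_eqF// subr_gt0.
have mg n : measurable_fun [set: R] (green F D (cst 1) n).
  exact: measurable_green.
have g0 n s : 0 <= green F D (cst 1) n s by exact: green_ge0.
suff H n : (n <= N)%N -> [/\ (forall s, (L <= s)%R -> occ F L n s <= W%:E * hit F n (s - L)%R),
    (forall s, (0 <= s <= L + B)%R ->
      occ F L n s <= green F D (cst 1) n s + (dl * W)%:E) &
    (forall s, (0 <= s)%R -> occ F L n s <= W%:E)].
  by have [] := H N (leqnn _).
elim: n => [|n IH] nN.
  split => s sL; have -> : occ F L 0 s = 0 by [].
  - by rewrite mule_ge0 ?hit_ge0// lee_fin.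
  - by rewrite add0e lee_fin mulr_ge0.
  - by rewrite lee_fin.
have {IH}[IHa IHb IHc] := IH (ltnW nN).
have Ha s : (L <= s)%R -> occ F L n.+1 s <= W%:E * hit F n.+1 (s - L)%R.
  move=> Ls; rewrite hitS ?subr_ge0// /occ /= belowE ltNge Ls add0e.
  have mh := measurable_hit_shift F n (s - L)%R.
  rewrite -ge0_integralZl//; last by move=> y _; exact: hit_ge0.
  apply: ge0_le_integral => //.
  - by move=> y _; apply: restr_ge0 => ?; exact: occ_ge0.
  - by apply: measurable_kill; [exact: measurable_alive|exact: measurable_occ].
  - by apply: measurable_funeM; exact: measurable_hit_shift.
  move=> y _; rewrite patchE mem_alive; case: ifPn => sy; last first.
    by rewrite mule_ge0 ?hit_ge0// lee_fin.
  have [Lsy|syL] := leP L (s - y)%R.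
    by rewrite addrAC; exact: IHa.
  rewrite hit_lt0; last by rewrite addrAC subr_lt0.
  by rewrite mule1; exact: IHc.
have Hb s : (0 <= s <= L + B)%R ->
    occ F L n.+1 s <= green F D (cst 1) n.+1 s + (dl * W)%:E.
  move=> sL; rewrite /occ /= -addeA; apply: leeD.
    by rewrite belowE lee_fin; case: ltP.
  rewrite -(integral_probc F (dl * W)) /step -ge0_integralD//; last 3 first.
  - by move=> y _; exact: restr_ge0.
  - exact: measurable_kill.
  - by move=> y _; rewrite lee_fin mulr_ge0.
  apply: ge0_le_integral => //.
  - by move=> y _; apply: restr_ge0 => ?; exact: occ_ge0.
  - by apply: measurable_kill; [exact: measurable_alive|exact: measurable_occ].
  - by apply: emeasurable_funD => //; exact: measurable_kill.
  move=> y _; rewrite !patchE mem_alive /D mem_itvcc; have [sy|sy] /= := leP 0%R (s - y)%R.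
    have [syL|Lsy] := leP (s - y)%R (L + B)%R.
      by apply: IHb; rewrite sy.
    rewrite add0e; apply: (le_trans (IHa _ _)).
      by apply: le_trans (ltW Lsy); rewrite lerDl.
    rewrite [(dl * W)%R]mulrC [leRHS]EFinM; apply: lee_wpmul2l; first by rewrite lee_fin.
    apply: le_trans hB; apply: (@le_trans _ _ (hit F N (s - y - L)%R)).
      by apply: hit_nd; exact: ltnW.
    by apply: le_hit; rewrite lerBrDl ltW.
  by rewrite add0e lee_fin mulr_ge0.
split => // s s0; have [sL|Ls] := leP s (L + B)%R.
  rewrite -WE EFinD; apply: (le_trans (Hb s _)); first by rewrite s0.
  by apply: leeD => //; apply: He; rewrite s0.
apply: (le_trans (Ha s _)); first by apply: le_trans (ltW Ls); rewrite lerDl.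
by rewrite -[leRHS]mule1; apply: lee_wpmul2l; [rewrite lee_fin|exact: hit_le1].
Qed.

End occupation.

(** * First passage decomposition and lower bound for visits *)

Section overshoot.
Context (R : realType) (F : probability (measurableTypeR R) R).
Context d (T : measurableType d) (mu : {sigma_finite_measure set T -> \bar R}).
Variables (c w : T -> R) (a u : R) (N : nat).
Hypotheses (mc : measurable_fun setT c) (mw : measurable_fun setT w).
Hypotheses (w0 : forall t, 0 <= w t) (u0 : 0 <= u).
Local Open Scope ereal_scope.

Let psi (z : R) : \bar R :=
  (a < z)%R%:R%:E + \int[mu]_t ((w t)%:E * (c t < z)%R%:R%:E).

Let Phi (s : R) : \bar R :=
  exceed F a s + \int[mu]_t ((w t)%:E * exceed F (c t) s).

Let b_ge0 (b : bool) : 0 <= b%:R%:E :> \bar R.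
Proof. by rewrite lee_fin. Qed.

Let wb_ge0 t (b : bool) : 0 <= (w t)%:E * b%:R%:E.
Proof. by rewrite mule_ge0// lee_fin. Qed.

Let we_ge0 t s : 0 <= (w t)%:E * exceed F (c t) s.
Proof. by rewrite mule_ge0 ?exceed_ge0// lee_fin. Qed.

Let m3 (s : R) : measurable_fun setT (fun v : T * measurableTypeR R =>
  (w v.1)%:E * (c v.1 < v.2 - s)%R%:R%:E).
Proof.
apply: emeasurable_funM.
  by apply/measurable_EFinP; exact: measurableT_comp mw measurable_fst.
apply: measurable_ltb; first exact: measurableT_comp mc measurable_fst.
by apply: measurable_funB; [exact: measurable_snd|exact: measurable_cst].
Qed.

Let psi_ge0 z : 0 <= psi z.
Proof. by rewrite adde_ge0//; apply: integral_ge0. Qed.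

Let mint (s : R) : measurable_fun [set: R]
  (fun y => \int[mu]_t ((w t)%:E * (c t < y - s)%R%:R%:E)).
Proof.
by apply: (measurable_fun_fubini_tonelli_G
  (fun v : T * measurableTypeR R => (w v.1)%:E * (c v.1 < v.2 - s)%R%:R%:E)).
Qed.

Let mpsi (s : R) : measurable_fun [set: R] (fun y => psi (y - s)%R).
Proof.
apply: emeasurable_funD => //.
by apply: measurable_ltb => //; exact: measurable_funB.
Qed.

Let exceedE z s : exceed F z s = \int[F]_y (z < y - s)%R%:R%:E.
Proof.
by rewrite exceed_below; apply: eq_integral => y _; rewrite belowE ltrBrDl ltrBrDr.
Qed.

Let mexceed2 : measurable_fun setT
  (fun v : measurableTypeR R * T => (w v.2)%:E * exceed F (c v.2) v.1).
Proof.
apply: emeasurable_funM.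
  by apply/measurable_EFinP; exact: measurableT_comp mw measurable_snd.
under eq_fun do rewrite exceedE.
apply: (measurable_fun_fubini_tonelli_F
  (fun v : (measurableTypeR R * T)%type * measurableTypeR R =>
    (c v.1.2 < v.2 - v.1.1)%R%:R%:E)) => //.
apply: measurable_ltb.
  by apply: measurableT_comp => //; exact: measurableT_comp measurable_snd measurable_fst.
apply: measurable_funB; first exact: measurable_snd.
exact: measurableT_comp measurable_fst measurable_fst.
Qed.

Let PhiE s : Phi s = \int[F]_y psi (y - s)%R.
Proof.
have s0 y : 0 <= \int[mu]_t ((w t)%:E * (c t < y - s)%R%:R%:E).
  exact: integral_ge0.
have ma : measurable_fun [set: R] (fun y => (a < y - s)%R%:R%:E : \bar R).
  by apply: measurable_ltb => //; exact: measurable_funB.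
rewrite /Phi /psi ge0_integralD//; last exact: mint.
rewrite exceedE; congr (_ + _).
rewrite -(fubini_tonelli (fun v : T * measurableTypeR R =>
  (w v.1)%:E * (c v.1 < v.2 - s)%R%:R%:E))//.
apply: eq_integral => t _; rewrite exceedE -ge0_integralZl//; last by rewrite lee_fin.
by apply: measurable_ltb => //; exact: measurable_funB.
Qed.

Let mPhi2 : measurable_fun [set: R]
  (fun s => \int[mu]_t ((w t)%:E * exceed F (c t) s)).
Proof.
exact: (measurable_fun_fubini_tonelli_F
  (fun v : measurableTypeR R * T => (w v.2)%:E * exceed F (c v.2) v.1)).
Qed.

Let mPhi : measurable_fun [set: R] Phi.
Proof. by apply: emeasurable_funD => //; exact: measurable_exceed. Qed.

Let Phi_ge0 s : 0 <= Phi s.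
Proof. by rewrite PhiE; apply: integral_ge0. Qed.

(** First passage decomposition at level [s], below the target [s + u]: after
    an overshoot [z] the remaining distance is [u - z]. The majorant [psi] of the
    conditional probability is a mixture of indicators of [c t < z], which turns
    the expectation over the overshoot into a mixture of overshoot tails. *)
Lemma hit_decomp : (forall z, (0 < z)%R -> hit F N (u - z)%R <= psi z) ->
  forall n s, (n <= N)%N -> (0 <= s)%R ->
  hit F n (s + u)%R <=
    jump F a n s + \int[mu]_t ((w t)%:E * jump F (c t) n s).
Proof.
move=> hpsi n s nN s0.
have mA := @measurable_alive R.
have e0 z s' : 0 <= exceed F z s' by exact: exceed_ge0.
have me z : measurable_fun [set: R] (exceed F z) by exact: measurable_exceed.
have mu0 s' : 0 <= \int[mu]_t ((w t)%:E * exceed F (c t) s').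
  exact: integral_ge0.
under eq_integral do rewrite -greenZ//.
rewrite -(@green_mix _ F _ _ mu _ (fun s t => (w t)%:E * exceed F (c t) s) mA)//.
rewrite -greenD// -/Phi.
elim: n s nN s0 => [|n IH] s nN s0.
  by rewrite /= ltNge addr_ge0.
rewrite hitS ?addr_ge0//= -/(Phi s) PhiE /step.
have mg : measurable_fun [set: R] (green F alive Phi n).
  exact: measurable_green.
have mk := measurable_kill s mA mg.
have gk0 y : 0 <= (green F alive Phi n \_ alive) (s - y)%R.
  by apply: restr_ge0; exact: green_ge0.
have mps := mpsi s.
rewrite -ge0_integralD//.
apply: ge0_le_integral => //.
- by move=> y _; exact: hit_ge0.
- exact: measurable_hit_shift.
- exact: emeasurable_funD.
move=> y _; rewrite patchE mem_alive subr_ge0; have [ys|sy] := leP y s.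
  rewrite addrAC (le_trans (IH (s - y)%R (ltnW nN) _)) ?subr_ge0//.
  by rewrite leeDr.
rewrite adde0 (_ : s + u - y = u - (y - s))%R; last by ring.
apply: le_trans (hpsi _ _); last by rewrite subr_gt0.
by apply: hit_nd; exact: ltnW.
Qed.

End overshoot.

Section overshoot_cor.
Context (R : realType) (F : probability (measurableTypeR R) R).
Local Open Scope ereal_scope.

(** Either the overshoot exceeds [a], or a fresh walk has still to climb
    [u - a]. *)
Lemma hit_split (a u c s : R) N : (0 <= u)%R -> (0 <= s)%R ->
  hit F N (u - a)%R <= c%:E ->
  hit F N (s + u)%R <= jump F a N s + c%:E * hit F N s.
Proof.
move=> u0 s0 hc; have c0 : (0 <= c)%R.
  by rewrite -lee_fin; apply: le_trans hc; exact: hit_ge0.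
have cstE (x : \bar R) (f : R -> \bar R) : (forall y, f y = x) -> \int[F]_y f y = x.
  move=> fx; rewrite (eq_integral (cst x)); last by move=> y _.
  rewrite integral_cst// -[RHS]mule1; congr (_ * _); exact: probability_setT.
have -> : c%:E * hit F N s = \int[F]_t ((cst c t)%:E * jump F (cst 0%R t) N s).
  by rewrite [RHS](cstE (c%:E * hit F N s))// => y; rewrite hit_jump.
apply: (@hit_decomp _ F _ _ F (cst 0%R) (cst c) a u N) => // z z0.
rewrite (cstE c%:E) => [|y]; last by rewrite z0 mule1.
have [az|za] := ltP a z.
  by rewrite (le_trans (hit_le1 _ _ _))// leeDl// lee_fin.
rewrite add0e; apply: (le_trans _ hc); apply: le_hit.
by rewrite lerD2l lerN2.
Qed.

End overshoot_cor.

Section lower.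
Context (R : realType) (F : probability (measurableTypeR R) R).
Local Open Scope ereal_scope.

(** Wald's identity for steps truncated at [t], as a subsolution: [a s] is the
    distance to the exit at depth [L = x + t], truncated at [t]. It is paid for by
    the visits, by the event that the walk is killed, and by the event, of
    probability [r N], that it is still inside after [N] steps. As [r] is
    nonincreasing, [N * r N] is at most the number of visits, which costs the
    term [t / N] in the denominator. *)
Lemma occ_lower (x t p : R) N : (0 < t)%R -> (0 <= x)%R -> hit F N x <= p%:E ->
  (0 < N)%N ->
  (t * (1 - p) / (nmom F t + t / N%:R))%:E <= occ F (x + t)%R N x.
Proof.
move=> t0 x0 hp N0; set L := (x + t)%R.
set D := `[0%R, L[%classic; have mD : measurable D by exact: measurable_itv.
have DE s : (s \in D) = (0 <= s < L)%R by rewrite /D mem_itvco.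
pose m := nmom F t; have m0 : (0 <= m)%R by apply: nmom_ge0; exact: ltW.
pose uu n s := green F D (below L) n s.
have uu0 n s : 0 <= uu n s by apply: green_ge0 => ?; exact: below_ge0.
have muu n : measurable_fun [set: R] (uu n).
  apply: measurable_green => //; first exact: measurable_below.
  by move=> ?; exact: below_ge0.
pose r n := iter n (step F D) (cst 1).
have r0 n s : 0 <= r n s.
  by elim: n s => [|n IH] s //=; exact: step_ge0.
have mr n : measurable_fun [set: R] (r n).
  by elim: n => [|n IH] //=; exact: measurable_step.
have r1 n s : r n s <= 1.
  elim: n s => [|n IH] s //=; rewrite -(integral_probc F 1).
  apply: ge0_le_integral => //.
  - by move=> y _; exact: restr_ge0.
  - exact: measurable_kill.
  - by move=> y _; rewrite patchE; case: ifP.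
have ru n s : D s -> n%:R%:E * r n s <= uu n s.
  elim: n s => [|n IH] s Ds; first by rewrite mul0e.
  rewrite -natr1 EFinD ge0_muleDl ?lee_fin// mul1e addeC /=.
  apply: leeD.
    rewrite belowE; move/mem_set: (Ds); rewrite DE => /andP[_ ->].
    exact: (r1 n.+1 s).
  have mnr : measurable_fun [set: R] (fun s' => n%:R%:E * r n s').
    exact: measurable_funeM.
  have nr0 s' : 0 <= n%:R%:E * r n s' by rewrite mule_ge0// lee_fin.
  by rewrite -stepZ//; exact: le_step.
pose a (s : R) := Num.min (L - s)%R t.
have main n (s : R) : (0 <= s < L)%R ->
    (a s)%:E <= m%:E * uu n s + t%:E * hit F n s + t%:E * r n s.
  elim: n s => [|n IH] s sL.
    rewrite /= mule0 add0e mule1 addeC; apply: (@le_trans _ _ t%:E).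
      by rewrite lee_fin /a ge_min lexx orbT.
    rewrite leeDl// mule_ge0//; first by rewrite lee_fin ltW.
    by case: ifP.
  have s0 : (0 <= s)%R by case/andP: sL.
  have mk1 := measurable_kill s mD (muu n).
  have mk2 := measurable_kill s mD (mr n).
  have mk3 := measurable_hit_shift F n s.
  have k10 y : 0 <= (uu n \_ D) (s - y)%R by exact: restr_ge0.
  have k20 y : 0 <= (r n \_ D) (s - y)%R by exact: restr_ge0.
  have k30 y : 0 <= hit F n (s - y)%R by exact: hit_ge0.
  have mE : 0 <= m%:E by rewrite lee_fin.
  have tE : 0 <= t%:E by rewrite lee_fin ltW.
  have Ek1 y : 0 <= m%:E * (uu n \_ D) (s - y)%R by exact: mule_ge0.
  have Ek2 y : 0 <= t%:E * (r n \_ D) (s - y)%R by exact: mule_ge0.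
  have Ek3 y : 0 <= t%:E * hit F n (s - y)%R by exact: mule_ge0.
  have mEk1 : measurable_fun [set: R] (fun y => m%:E * (uu n \_ D) (s - y)%R).
    exact: measurable_funeM.
  have mEk2 : measurable_fun [set: R] (fun y => t%:E * (r n \_ D) (s - y)%R).
    exact: measurable_funeM.
  have mEk3 : measurable_fun [set: R] (fun y => t%:E * hit F n (s - y)%R).
    exact: measurable_funeM.
  have np0 y : 0 <= (npart t y)%:E by rewrite lee_fin npart_ge0// ltW.
  have mnp : measurable_fun [set: R] (EFin \o npart t).
    by apply/measurable_EFinP; exact: measurable_npart.
  have mEk13 : measurable_fun [set: R]
      (fun y => m%:E * (uu n \_ D) (s - y)%R + t%:E * hit F n (s - y)%R).
    exact: emeasurable_funD.
  have mEk132 : measurable_fun [set: R]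
      (fun y => m%:E * (uu n \_ D) (s - y)%R + t%:E * hit F n (s - y)%R +
        t%:E * (r n \_ D) (s - y)%R).
    exact: emeasurable_funD.
  have Ek13 y : 0 <= m%:E * (uu n \_ D) (s - y)%R + t%:E * hit F n (s - y)%R.
    exact: adde_ge0.
  have Ek132 y : 0 <= m%:E * (uu n \_ D) (s - y)%R + t%:E * hit F n (s - y)%R +
      t%:E * (r n \_ D) (s - y)%R.
    exact: adde_ge0.
  have -> : m%:E * uu n.+1 s + t%:E * hit F n.+1 s + t%:E * r n.+1 s =
      \int[F]_y ((npart t y)%:E + (m%:E * (uu n \_ D) (s - y)%R +
        t%:E * hit F n (s - y)%R + t%:E * (r n \_ D) (s - y)%R)).
    rewrite !ge0_integralD// !ge0_integralZl// nmomE ?(ltW t0)//.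
    rewrite hitS// {1}/uu [green _ _ _ n.+1 s]/= belowE; have /andP[_ ->] := sL.
    rewrite ge0_muleDr//; last exact: step_ge0.
    by rewrite mule1 -!addeA.
  have a0 : (0 <= a s)%R by rewrite /a le_min (ltW t0) andbT; lra.
  rewrite -(integral_probc F (a s)); apply: ge0_le_integral => //.
  - by apply: emeasurable_funD.
  move=> y _; rewrite /cst !patchE !DE.
  have np0' := np0 y; have at_ : (a s <= t)%R by rewrite /a ge_min lexx orbT.
  have [sy|ys] := ltP s y.
    rewrite hit_lt0 ?subr_lt0// mule1.
    have -> /= : (0 <= s - y)%R = false by apply/negbTE; rewrite -ltNge subr_lt0.
    rewrite !mule0 add0e adde0; apply: (@le_trans _ _ t%:E); first by rewrite lee_fin.
    by rewrite leeDr.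
  rewrite [(0 <= s - y)%R]subr_ge0 ys/=; case: ifPn => syL.
    apply: (@le_trans _ _ ((npart t y)%:E + (a (s - y))%:E)); last first.
      by apply: leeD => //; apply: IH; rewrite subr_ge0 ys.
    have -> : a (s - y)%R = Num.min (L - s + y)%R t.
      by rewrite /a opprD opprK addrA.
    by rewrite -EFinD lee_fin /a min_le_npart ?(ltW t0)//; move: syL; clear; lra.
  rewrite !mule0 add0e adde0.
  apply: (@le_trans _ _ (npart t y)%:E); last by rewrite leeDl// mule_ge0// hit_ge0.
  move: syL; rewrite -leNgt => syL.
  rewrite lee_fin le_npart// /a ge_min; apply/orP; left; lra.
have xL : (0 <= x < L)%R by rewrite x0 ltrDl.
have DL : D x by rewrite /D/= in_itv/=.
have := main N x xL; rewrite /a /L addrAC subrr add0r minxx => H.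
have {}H : t%:E <= (m + t / N%:R)%:E * uu N x + (t * p)%:E.
  apply: (le_trans H); rewrite EFinD ge0_muleDl ?lee_fin ?divr_ge0 ?ler0n ?(ltW t0)//.
  rewrite addeAC; apply: leeD.
    apply: leeD => //; apply: (@le_trans _ _ ((t / N%:R)%:E * (N%:R%:E * r N x))).
      by rewrite muleA -EFinM divfK// pnatr_eq0 -lt0n.
    by apply: lee_wpmul2l; [rewrite lee_fin divr_ge0// ltW|exact: ru].
  by rewrite EFinM; apply: lee_wpmul2l; [rewrite lee_fin ltW|].
have d0 : (0 < m + t / N%:R)%R by rewrite ltr_wpDl// divr_gt0// ltr0n.
apply: (@le_trans _ _ (uu N x)); last first.
  apply: le_green => //; [exact: measurable_alive|exact: measurable_below|
    by move=> ?; exact: below_ge0|exact: measurable_below|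
    by move=> ?; exact: below_ge0|].
  by move=> z; rewrite /D /alive/= !in_itv/= andbT => /andP[].
rewrite -(@lee_pmul2l _ (m + t / N%:R)%:E)// -EFinM.
rewrite mulrC divfK ?gt_eqF// mulrBr mulr1 EFinB leeBlDr//.
Qed.

End lower.

(** * The renewal rate t / m t *)

Section ratio.
Context (R : realType) (F : probability (measurableTypeR R) R).

Lemma le_nmom s t : 0 <= s -> s <= t -> nmom F s <= nmom F t.
Proof.
move=> s0 st; have t0 := le_trans s0 st.
rewrite -lee_fin -!nmomE//; apply: ge0_le_integral => //.
- by move=> y _; rewrite lee_fin npart_ge0.
- by apply/measurable_EFinP; exact: measurable_npart.
- by apply/measurable_EFinP; exact: measurable_npart.
- move=> y _; rewrite lee_fin /npart le_min ge_min lexx /= ge_min st orbT.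
  by [].
Qed.

Lemma nmom_concave s t : 0 <= s -> s <= t -> s * nmom F t <= t * nmom F s.
Proof.
move=> s0 st; have t0 := le_trans s0 st.
have mn L : measurable_fun [set: R] (fun y => (npart L y)%:E).
  by apply/measurable_EFinP; exact: measurable_npart.
have n0 L y : 0 <= L -> (0 <= (npart L y)%:E)%E by move=> L0; rewrite lee_fin npart_ge0.
rewrite -lee_fin !EFinM -!nmomE// -!ge0_integralZl//; try exact: mn;
  try by move=> y _; exact: n0.
apply: ge0_le_integral => //.
- by move=> y _; rewrite mule_ge0 ?n0.
- by apply: measurable_funeM; exact: mn.
- by apply: measurable_funeM; exact: mn.
- move=> y _; rewrite -!EFinM lee_fin /npart.
  have a0 : 0 <= Num.max (- y) 0 by rewrite le_max lexx orbT.
  move: (Num.max _ _) a0 => a a0; rewrite !minr_pMr// le_min !ge_min.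
  by rewrite (mulrC t s) lexx orbT andbT ler_wpM2r.
Qed.

(** The value 0 on the negative half-line makes the function nondecreasing
    everywhere, and lets integrals over half-lines be written as integrals over
    the line. *)
Definition mratio (t : R) : R := if 0 < t then t / nmom F t else 0.

Hypothesis nmomy : forall K : R, exists2 L, 0 < L & forall t, L <= t -> K <= nmom F t.

Lemma nmom_gt0 t : 0 < t -> 0 < nmom F t.
Proof.
move=> t0; have [L L0 HL] := nmomy 1.
pose u := Num.max L t; have tu : t <= u by rewrite le_max lexx orbT.
have Lu : L <= u by rewrite le_max lexx.
have := nmom_concave (ltW t0) tu.
have u0 : 0 < u := lt_le_trans t0 tu.
rewrite -ler_pdivrMl// => /(lt_le_trans _); apply.
by rewrite mulr_gt0 ?invr_gt0// mulr_gt0// (lt_le_trans _ (HL u Lu)).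
Qed.

Lemma mratio_gt0 t : 0 < t -> 0 < mratio t.
Proof. by move=> t0; rewrite /mratio t0 divr_gt0// nmom_gt0. Qed.

Lemma mratio_ge0 t : 0 <= mratio t.
Proof. by have [/mratio_gt0/ltW//|t0] := ltP 0 t; rewrite /mratio ltNge t0. Qed.

Lemma le_mratio s t : s <= t -> mratio s <= mratio t.
Proof.
have [s0|s0] := ltP 0 s; last by move=> _; rewrite {1}/mratio ltNge s0 mratio_ge0.
move=> st; have t0 := lt_le_trans s0 st.
rewrite /mratio s0 t0 ler_pdivrMr ?nmom_gt0// mulrAC ler_pdivlMr ?nmom_gt0//.
exact: nmom_concave (ltW s0) st.
Qed.

(** Since [m] is nondecreasing, [t / m t] grows at most linearly. *)
Lemma mratio_scale s t : 0 < s -> s <= t -> mratio t <= t / s * mratio s.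
Proof.
move=> s0 st; have t0 := lt_le_trans s0 st.
rewrite /mratio s0 t0 mulrA divfK ?gt_eqF// ler_pM2l// lef_pV2 ?posrE ?nmom_gt0//.
exact: le_nmom (ltW s0) st.
Qed.

Lemma measurable_mratio : measurable_fun [set: R] mratio.
Proof. by apply: nondecreasing_measurable => // s t; exact: le_mratio. Qed.

Lemma npart_le_split (a t y : R) : 0 <= a -> 0 <= t ->
  npart t y <= a + t * (y < - a)%R%:R.
Proof.
move=> a0 t0; rewrite /npart /Num.min /Num.max.
by case: (ltP y (- a)); rewrite ?mulr1 ?mulr0;
  repeat case: ifPn; rewrite -?leNgt; lra.
Qed.

Lemma left_tail_small (e : R) : 0 < e ->
  exists2 a : R, 0 <= a & (F `]-oo, (- a)%R[%classic <= e%:E)%E.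
Proof.
move=> e0; pose A (n : nat) : set R := `]-oo, (- n%:R)[%classic.
have : (F \o A) n @[n --> \oo] --> F (\bigcap_n A n).
  apply: nonincreasing_cvg_mu => //.
  - by rewrite (le_lt_trans (probability_le1 _ _))// ?ltry//; exact: measurable_itv.
  - by move=> n; exact: measurable_itv.
  - by apply: bigcap_measurable => // n _; exact: measurable_itv.
  - move=> m n mn; apply/subsetPset => y; rewrite /A/= !in_itv/= => /lt_le_trans.
    by apply; rewrite lerN2 ler_nat.
have -> : \bigcap_n A n = set0.
  rewrite -subset0 => y /(_ (Num.bound `|y|) I).
  rewrite /A/= in_itv/= ltNge => /negP; apply; rewrite lerNl.
  by rewrite (le_trans (ler_norm _))// normrN ltW// archi_boundP.
rewrite measure0 => /fine_cvgP[_ /cvgrPdist_le/(_ e e0)[n _ /(_ n (leqnn n))]].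
rewrite /= sub0r normrN ger0_norm; last exact/fine_ge0.
move=> An; exists n%:R => //; rewrite -lee_fin in An; apply: le_trans An.
rewrite fineK// ge0_fin_numE// (le_lt_trans (probability_le1 _ _)) ?ltry//.
exact: measurable_itv.
Qed.

(** [m t / t] tends to 0, because [m t <= a + t * P (xi^- > a)]. *)
Lemma mratio_unbounded (K : R) : exists2 c, 0 < c & forall t, c <= t -> K <= mratio t.
Proof.
pose k := Num.max K 1; have k0 : 0 < k by rewrite lt_max ltr01 orbT.
have k20 : 0 < (2 * k)^-1 by rewrite invr_gt0 mulr_gt0.
have [a a0 ha] := left_tail_small k20.
exists (2 * k * (a + 1)); first by rewrite !mulr_gt0// ltr_wpDl.
move=> t ct; have t0 : 0 < t by apply: lt_le_trans ct; rewrite !mulr_gt0// ltr_wpDl.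
have mt : nmom F t <= a + t * (2 * k)^-1.
  have tE := ltW t0; rewrite -lee_fin -nmomE//.
  apply: (@le_trans _ _ (\int[F]_y (a%:E + t%:E * (y < - a)%R%:R%:E))%E).
    apply: ge0_le_integral => //.
    - by move=> y _; rewrite lee_fin npart_ge0// ltW.
    - by apply/measurable_EFinP; exact: measurable_npart.
    - apply: emeasurable_funD => //; apply: measurable_funeM.
      exact: measurable_ltb.
    - by move=> y _; rewrite -EFinM -EFinD lee_fin npart_le_split// ltW.
  have mb : measurable_fun [set: R] (fun y => (y < - a)%R%:R%:E : \bar R).
    exact: measurable_ltb.
  have b0 (y : R) : (0 <= (y < - a)%R%:R%:E)%E by rewrite lee_fin.
  have tb0 (y : R) : (0 <= t%:E * (y < - a)%R%:R%:E)%E by rewrite mule_ge0// lee_fin.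
  have mtb : measurable_fun [set: R] (fun y => t%:E * (y < - a)%R%:R%:E : \bar R)%E.
    exact: measurable_funeM.
  rewrite ge0_integralD// (integral_probc F a) ge0_integralZl//.
  rewrite EFinD leeD2l// EFinM; apply: lee_wpmul2l; first by rewrite lee_fin.
  apply: le_trans ha; rewrite -[X in (_ <= F X)%E]setIT -integral_indic//.
  apply: ge0_le_integral => //.
    by apply/measurable_EFinP; apply: measurable_indic; exact: measurable_itv.
  move=> y _; rewrite lee_fin indicE ler_nat; case: ltP => // ya.
  by rewrite mem_set//= in_itv.
rewrite /mratio t0; have m0 := nmom_gt0 t0.
apply: (@le_trans _ _ k); first by rewrite le_max lexx.
rewrite ler_pdivlMr// (le_trans (ler_wpM2l (ltW k0) mt))// mulrDr mulrCA.
rewrite (_ : k * (2 * k)^-1 = 2^-1); last by field; rewrite gt_eqF.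
by nra.
Qed.

End ratio.

(** * Tails of integrals *)

Section tail_integrals.
Context (R : realType) (F : probability (measurableTypeR R) R).
Hypothesis nmomy : forall K : R, exists2 L, 0 < L & forall t, L <= t -> K <= nmom F t.
Hypothesis mratio_int : (\int[F]_y (mratio F y)%:E < +oo)%E.
Local Open Scope ereal_scope.

Let r0 y := mratio_ge0 nmomy y.
Let mr := measurable_mratio nmomy.

Definition rtail (B : R) : \bar R := \int[F]_y ((B < y)%R%:R * mratio F y)%:E.

Let rt0 (B y : R) : (0 <= (B < y)%R%:R * mratio F y)%R.
Proof. by rewrite mulr_ge0. Qed.

Lemma measurable_rtail (B : R) : measurable_fun [set: R] (fun y => ((B < y)%R%:R * mratio F y)%:E).
Proof.
under eq_fun do rewrite EFinM; apply: emeasurable_funM; last exact/measurable_EFinP.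
exact: measurable_ltb.
Qed.

Lemma le_rtail (B B' : R) : (B <= B')%R -> rtail B' <= rtail B.
Proof.
move=> BB'; apply: ge0_le_integral => //.
- by move=> y _; rewrite lee_fin.
- exact: measurable_rtail.
- exact: measurable_rtail.
move=> y _; rewrite lee_fin ler_wpM2r// ler_nat.
by case: (ltP B' y) => // /(le_lt_trans BB') ->.
Qed.

Lemma rtail_small (e : R) : (0 < e)%R ->
  exists2 B, (0 < B)%R & forall B', (B <= B')%R -> rtail B' <= e%:E.
Proof.
move=> e0.
pose f n (y : R) := ((n%:R < y)%R%:R * mratio F y)%:E : \bar R.
have f0 : {ae F, forall y, setT y -> f ^~ y @ \oo --> (cst 0 y : \bar R)}.
  apply: aeW => y _; apply: cvg_near_cst.
  exists (Num.bound `|y|) => //= n /= yn.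
  rewrite /f ltNge (_ : (y <= n%:R)%R = true) ?mul0r//.
  rewrite (le_trans (ler_norm y))// (le_trans (ltW (archi_boundP _)))//.
  by rewrite ler_nat.
have ig : F.-integrable setT (EFin \o mratio F).
  apply/integrableP; split; first exact/measurable_EFinP.
  by under eq_integral do rewrite /= ger0_norm//.
have fg : {ae F, forall (y : R) n, setT y -> `|f n y| <= (EFin \o mratio F) y}.
  apply: aeW => y n _; rewrite lee_fin ger0_norm// ler_piMl//.
  by case: (_ < _)%R.
have mf n : measurable_fun [set: measurableTypeR R] (f n) by exact: measurable_rtail.
have [_ _] := @dominated_convergence _ _ _ F setT measurableT f (cst 0)
  (EFin \o mratio F) mf (measurable_cst _) f0 ig fg.
rewrite integral0 => /fine_cvgP[].
move=> [n0 _ fin] /cvgrPdist_le/(_ e e0)[n1 _ small].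
pose n := (maxn n0 n1).+1; exists n%:R; first by rewrite ltr0n.
move=> B' /le_rtail/le_trans; apply.
have fn : rtail n%:R \is a fin_num by apply: fin => /=; rewrite leqW// leq_maxl.
rewrite -(fineK fn) lee_fin.
have := small n; rewrite /= sub0r normrN leqW ?leq_maxr// => /(_ isT).
by rewrite ger0_norm//; apply/fine_ge0/integral_ge0 => y _; rewrite lee_fin.
Qed.

Lemma tail_le_rtail (x : R) : (1 <= x)%R ->
  F `]x, +oo[%classic <= (mratio F 1)^-1%:E * rtail x.
Proof.
move=> x1; have r1 := mratio_gt0 nmomy ltr01.
rewrite /rtail -ge0_integralZl//; last 3 first.
- exact: measurable_rtail.
- by move=> y _; rewrite lee_fin.
- by rewrite lee_fin invr_ge0 ltW.
rewrite -[X in F X]setIT -integral_indic//; apply: ge0_le_integral => //.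
- by apply/measurable_EFinP; apply: measurable_indic; exact: measurable_itv.
- by apply: measurable_funeM; exact: measurable_rtail.
move=> y _; rewrite -EFinM lee_fin indicE; have [xy|xy] := ltP x y; last first.
  by rewrite mul0r mulr0 (memNset _)//= in_itv/= andbT ltNge xy.
rewrite mem_set ?mul1r/= ?in_itv/= ?xy//.
rewrite mulrC ler_pdivlMr// mul1r.
by apply: le_mratio => //; rewrite (le_trans x1)// ltW.
Qed.

Lemma tail_small (e : R) : (0 < e)%R ->
  exists2 x, (0 < x)%R & forall x', (x <= x')%R -> F `]x', +oo[%classic <= e%:E.
Proof.
move=> e0; have r1 := mratio_gt0 nmomy ltr01.
have [B B0 HB] := rtail_small (mulr_gt0 r1 e0).
exists (Num.max 1 B)%R; first by rewrite lt_max B0 orbT.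
move=> x; rewrite ge_max => /andP[x1 /HB xB].
apply: (le_trans (tail_le_rtail x1)); rewrite -[e](mulKf (lt0r_neq0 r1)) EFinM.
by apply: lee_wpmul2l => //; rewrite lee_fin invr_ge0 ltW.
Qed.

(** For a fixed horizon the maximum is finite: split on whether the first step
    exceeds [z]. *)
Lemma hit_small N (e : R) : (0 < e)%R ->
  exists2 x, (0 < x)%R & hit F N x <= e%:E.
Proof.
elim: N e => [|N IH] e e0.
  by exists 1%R => //=; rewrite ltNge ler01/= lee_fin ltW.
have e20 : (0 < e / 2)%R by rewrite divr_gt0.
have [x x0 hx] := IH _ e20; have [z z0 hz] := tail_small e20.
exists (x + z)%R; first exact: addr_gt0.
rewrite hitS; last by rewrite ltW// addr_gt0.
apply: (@le_trans _ _ (\int[F]_y (below (y - z)%R 0%R + (e / 2)%:E))).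
  apply: ge0_le_integral => //.
  - by move=> y _; exact: hit_ge0.
  - exact: measurable_hit_shift.
  - apply: emeasurable_funD => //.
    exact: measurable_below_shift.
  move=> y _; rewrite belowE subr_gt0; have [zy|yz] := ltP z y.
    by rewrite (le_trans (hit_le1 _ _ _))// leeDl// lee_fin ltW.
  by rewrite add0e (le_trans _ hx)// le_hit// -addrA lerDl subr_ge0.
rewrite ge0_integralD//; last 3 first.
- by move=> y _; exact: below_ge0.
- exact: measurable_below_shift.
- by move=> y _; rewrite lee_fin ltW.
rewrite (integral_probc F) -exceed_below [in leRHS](splitr e) EFinD leeD2r//.
by apply: hz; rewrite add0r.
Qed.

End tail_integrals.

(** * Finiteness of the supremum *)

Section supremum_finite.
Context (R : realType) (F : probability (measurableTypeR R) R).
Hypothesis nmomy : forall K : R, exists2 L, 0 < L & forall t, L <= t -> K <= nmom F t.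
Hypothesis ratio_int : (\int[F]_y (mratio F y)%:E < +oo)%E.
Local Open Scope ereal_scope.

Let r0 y := mratio_ge0 nmomy y.
Let mr := measurable_mratio nmomy.

(** Above [K], the truncated step [min (y, L)] is at most [m L * (y / m y)],
    because both [m] and [t / m t] are nondecreasing. *)
Lemma pmom_le (K L : R) : (0 < K)%R -> (0 < L)%R ->
  (pmom F L)%:E <= K%:E + (nmom F L)%:E * rtail F K.
Proof.
move=> K0 L0; have m0 := nmom_gt0 nmomy L0.
have t0 (y : R) : 0 <= ((K < y)%R%:R * mratio F y)%:E by rewrite lee_fin mulr_ge0.
have mt := measurable_rtail nmomy K.
have mmt : measurable_fun [set: R]
    (fun y => (nmom F L)%:E * ((K < y)%R%:R * mratio F y)%:E).
  exact: measurable_funeM.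
have m0E : 0 <= (nmom F L)%:E by rewrite lee_fin ltW.
have mt0 (y : R) : 0 <= (nmom F L)%:E * ((K < y)%R%:R * mratio F y)%:E.
  exact: mule_ge0.
have K0E : 0 <= K%:E by rewrite lee_fin ltW.
rewrite /rtail -(pmomE F (ltW L0)) -(integral_probc F K) -ge0_integralZl//.
rewrite -ge0_integralD//; apply: ge0_le_integral => //.
- by move=> y _; rewrite lee_fin ppart_ge0// ltW.
- by apply/measurable_EFinP; exact: measurable_ppart.
- exact: emeasurable_funD.
move=> y _; rewrite /cst -EFinM -EFinD lee_fin.
have [Ky|yK] := ltP K y; last first.
  rewrite mul0r mulr0 addr0 (le_trans (ppart_le_max _ _))// ge_max yK.
  exact: ltW.
apply: (@le_trans _ _ (nmom F L * mratio F y)%R); last by rewrite mul1r lerDr ltW.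
have y0 := lt_trans K0 Ky.
have [yL|Ly] := leP y L.
  have : (y = nmom F y * mratio F y)%R.
    by rewrite /mratio y0 mulrC divfK// gt_eqF// nmom_gt0.
  move=> yE; apply: (@le_trans _ _ y).
    by rewrite (le_trans (ppart_le_max _ _))// max_l// ltW.
  by rewrite {1}yE ler_wpM2r// le_nmom// ltW.
have : (L = nmom F L * mratio F L)%R.
  by rewrite /mratio L0 mulrC divfK// gt_eqF// nmom_gt0.
move=> LE; apply: (@le_trans _ _ L); first exact: ppart_le.
rewrite {1}LE; apply: ler_wpM2l; first exact: ltW.
by apply: le_mratio => //; exact: ltW.
Qed.

(** The integral condition makes upward steps negligible in truncated mean. *)
Lemma pmom_small (e : R) : (0 < e)%R ->
  exists2 L, (0 < L)%R & forall L', (L <= L')%R -> (pmom F L' <= e * nmom F L')%R.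
Proof.
move=> e0; have e20 : (0 < e / 2)%R by rewrite divr_gt0.
have [K K0 HK] := rtail_small nmomy ratio_int e20.
have [L L0 HL] := nmomy (K / (e / 2)).
exists L => // L' LL'; have L'0 := lt_le_trans L0 LL'.
have m0 := nmom_gt0 nmomy L'0; have := HL _ LL'.
rewrite ler_pdivrMr// => KL.
rewrite -lee_fin; apply: (le_trans (pmom_le K0 L'0)).
apply: (@le_trans _ _ (K%:E + (nmom F L')%:E * (e / 2)%:E)).
  by apply: leeD => //; apply: lee_wpmul2l; [rewrite lee_fin ltW|exact: HK].
rewrite -EFinM -EFinD lee_fin.
by lra.
Qed.

Lemma occ_le (eta dl L0 L B s : R) N : (0 < eta < 1)%R -> (0 <= dl < 1)%R ->
  (forall L', (L0 <= L')%R -> (pmom F L' <= eta * nmom F L')%R) ->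
  (0 < L)%R -> (0 <= B)%R -> (L0 <= L + B)%R -> hit F N B <= dl%:E ->
  (0 <= s)%R ->
  occ F L N s <= (2 / ((1 - eta) * (1 - dl)) * mratio F (L + B))%:E.
Proof.
move=> /andP[eta0 eta1] dl01 Hp L_gt0 B0 LB hB s0.
have LB0 : (0 < L + B)%R by rewrite ltr_wpDr.
have m0 := nmom_gt0 nmomy LB0; have pe := Hp _ LB.
have n1 : (0 < 1 - eta)%R by rewrite subr_gt0.
have d1 : (0 < 1 - dl)%R by rewrite subr_gt0; case/andP: dl01.
pose e := (2 / (1 - eta) * mratio F (L + B))%R.
have e0 : (0 <= e)%R by rewrite mulr_ge0// divr_ge0// ltW.
have -> : (2 / ((1 - eta) * (1 - dl)) * mratio F (L + B) = e / (1 - dl))%R.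
  by rewrite /e; field; rewrite !gt_eqF.
apply: occ_bound hB _ _ s0 => //.
move=> n s' s'LB; apply: (le_trans (green_exit n LB0 _ s'LB)).
  by apply: (le_lt_trans pe); rewrite -[ltRHS]mul1r ltr_pM2r.
have np : ((1 - eta) * nmom F (L + B) <= nmom F (L + B) - pmom F (L + B))%R by lra.
have en0 : (0 < (1 - eta) * nmom F (L + B))%R by rewrite mulr_gt0.
rewrite lee_fin /e /mratio LB0.
rewrite (_ : 2 / (1 - eta) * _ = 2 * (L + B) / ((1 - eta) * nmom F (L + B)))%R; last first.
  by field; rewrite !gt_eqF.
rewrite ler_wpM2l//; first by rewrite mulr_ge0// ltW.
by rewrite lef_pV2// posrE// (lt_le_trans en0).
Qed.

(** The constant is [2 / ((1 - 1/2) * (1 - 1/2))], and [y - z + B <= y]. *)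
Lemma jump_le_rtail (L0 B z s : R) N :
  (forall L', (L0 <= L')%R -> (pmom F L' <= 2^-1 * nmom F L')%R) ->
  (0 < B)%R -> (L0 <= B)%R -> (B <= z)%R -> hit F N B <= (2^-1)%:E ->
  (0 <= s)%R -> jump F z N s <= 8%:E * rtail F z.
Proof.
move=> Hp B0 LB Bz hB s0.
have t0 (y : R) : 0 <= ((z < y)%R%:R * mratio F y)%:E by rewrite lee_fin mulr_ge0.
have mt := measurable_rtail nmomy z.
rewrite jump_occ /rtail -ge0_integralZl//.
apply: ge0_le_integral => //.
- by move=> y _; exact: occ_ge0.
- exact: measurable_occ_shift.
- exact: measurable_funeM.
move=> y _; have [zy|yz] := ltP z y; last first.
  by rewrite occ_le0 ?subr_le0// mule_ge0// lee_fin mulr_ge0.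
rewrite mul1r -EFinM.
have h1 : (0 < (2^-1 : R) < 1)%R by apply/andP; split; lra.
have h2 : (0 <= (2^-1 : R) < 1)%R by apply/andP; split; lra.
have yz0 : (0 < y - z)%R by rewrite subr_gt0.
have LyB : (L0 <= y - z + B)%R by rewrite (le_trans LB)// lerDr ltW.
apply: (le_trans (occ_le h1 h2 Hp yz0 (ltW B0) LyB hB s0)).
rewrite (_ : 2 / _ = 8 :> R)%R; last by field.
rewrite lee_fin ler_wpM2l// le_mratio// -addrA gerDl addrC subr_le0//.
Qed.

(** Any level [B >= B1] with [hit F N B <= 1/2] can be replaced by [3 B / 4]: the
    first passage over [B] followed by a second one gives
    [hit F N (3 B) <= 1/4 + 1/16], and a walk started at depth [3 B / 4] is
    deeper than [3 B] before being killed, up to an event of probability 1/16.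
    The resulting bound [B1] does not depend on the horizon [N]. *)
Lemma hit_half : exists2 B : R, (0 < B)%R & forall N, hit F N B <= (2^-1)%:E.
Proof.
have h0 : (0 < (2^-1 : R))%R by rewrite invr_gt0.
have e0 : (0 < (200^-1 : R))%R by rewrite invr_gt0.
have [L1 L10 H1] := pmom_small h0; have [L2 L20 H2] := pmom_small e0.
have j0 : (0 < (128^-1 : R))%R by rewrite invr_gt0.
have [L3 L30 H3] := rtail_small nmomy ratio_int j0.
pose B1 := Num.max L1 (Num.max L2 L3).
have B10 : (0 < B1)%R by rewrite lt_max L10.
have key N (B : R) : (B1 <= B)%R -> hit F N B <= (2^-1)%:E ->
    hit F N (3 * B / 4)%R <= (2^-1)%:E.
  rewrite !ge_max => /andP[L1B /andP[L2B L3B]] hB.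
  have B0 : (0 < B)%R := lt_le_trans L10 L1B.
  have h3B : hit F N (3 * B)%R <= (16^-1 + 4^-1)%:E.
    rewrite (_ : 3 * B = B + 2 * B)%R; last by ring.
    apply: (le_trans (@hit_split _ F B (2 * B) 2^-1 B N _ _ _)).
    + by rewrite mulr_ge0// ltW.
    + exact: ltW.
    + by rewrite (_ : 2 * B - B = B)%R//; ring.
    rewrite EFinD; apply: leeD.
      apply: (le_trans (jump_le_rtail H1 B0 L1B (lexx B) hB (ltW B0))).
      apply: (@le_trans _ _ (8%:E * (128^-1)%:E)).
        by apply: lee_wpmul2l; [rewrite lee_fin|exact: H3].
      by rewrite -EFinM lee_fin; lra.
    rewrite (_ : 4^-1 = 2^-1 * 2^-1 :> R)%R; last by field.
    by rewrite EFinM; apply: lee_wpmul2l => //; rewrite lee_fin ltW.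
  have B30 : (0 < 3 * B)%R by rewrite mulr_gt0.
  have B3 : (L2 <= 3 * B)%R by lra.
  have p3 := H2 _ B3; have m3 := nmom_gt0 nmomy B30.
  have mp : (pmom F (3 * B) < nmom F (3 * B))%R by lra.
  apply: (le_trans (hit_exit_up N _ mp)); first by apply/andP; split; lra.
  apply: (@le_trans _ _ ((16^-1)%:E + (16^-1 + 4^-1)%:E)); last first.
    by rewrite -EFinD lee_fin; lra.
  apply: leeD => //; rewrite lee_fin.
  rewrite (_ : 2 * (3 * B) / (3 * B / 4) = 8)%R; last by field; rewrite gt_eqF.
  rewrite mulrA ler_pdivrMr ?subr_gt0//; lra.
have iter k N (B : R) : (B <= B1 + k%:R * (B1 / 4))%R -> hit F N B <= (2^-1)%:E ->
    hit F N B1 <= (2^-1)%:E.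
  elim: k B => [|k IH] B; first by rewrite mul0r addr0 => BB hB; exact: le_trans (le_hit F N BB) hB.
  have [BB1|B1B] := leP B B1.
    by move=> _ hB; exact: le_trans (le_hit F N BB1) hB.
  rewrite -natr1 => BB hB; apply: (IH (3 * B / 4)%R); first by lra.
  by apply: key => //; exact: ltW.
exists B1 => // N; have [x x0 hx] := hit_small nmomy ratio_int N h0.
apply: (iter (Num.bound (x / (B1 / 4))) N x) => //.
have B40 : (0 < B1 / 4)%R by rewrite divr_gt0.
have := archi_boundP (ltW (divr_gt0 x0 B40)).
by rewrite ltr_pdivrMr//; lra.
Qed.

(** Beyond one more level, the probability is multiplied by 1/2, up to a large
    overshoot, whose probability is small uniformly in the horizon. *)
Lemma hit_vanish (e : R) : (0 < e)%R ->
  exists2 B : R, (0 < B)%R & forall N, hit F N B <= e%:E.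
Proof.
have [B0 B00 hB0] := hit_half.
have h0 : (0 < (2^-1 : R))%R by rewrite invr_gt0.
have [L1 L10 H1] := pmom_small h0.
pose B := Num.max B0 L1; have BB0 : (0 < B)%R by rewrite lt_max B00.
have hB N : hit F N B <= (2^-1)%:E.
  by apply: le_trans (hB0 N); apply: le_hit; rewrite le_max lexx.
have LB : (L1 <= B)%R by rewrite le_max lexx orbT.
have key k : exists2 x : R, (0 < x)%R & forall N, hit F N x <= ((3 / 4) ^+ k)%:E.
  elim: k => [|k [x x0 hx]].
    by exists 1%R => // N; rewrite expr0 hit_le1.
  pose c := ((3 / 4) ^+ k : R)%R; have c0 : (0 < c)%R by rewrite exprn_gt0// divr_gt0.
  have c32 : (0 < c / 32)%R by rewrite divr_gt0.
  have [z z0 hz] := rtail_small nmomy ratio_int c32.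
  pose z' := Num.max z B; have Bz : (B <= z')%R by rewrite le_max lexx orbT.
  have zz : (z <= z')%R by rewrite le_max lexx.
  have z'0 : (0 < z')%R := lt_le_trans z0 zz.
  exists (B + (x + z'))%R; first by rewrite !addr_gt0.
  move=> N; apply: (le_trans (@hit_split _ F z' (x + z') c B N _ _ _)).
  - by rewrite addr_ge0// ltW.
  - exact: ltW.
  - by rewrite addrK; exact: hx.
  apply: (@le_trans _ _ (8%:E * (c / 32)%:E + c%:E * (2^-1)%:E)).
    apply: leeD.
      apply: (le_trans (jump_le_rtail H1 BB0 LB Bz (hB N) (ltW BB0))).
      by apply: lee_wpmul2l; [rewrite lee_fin|exact: hz].
    by apply: lee_wpmul2l => //; rewrite lee_fin ltW.
  by rewrite -!EFinM -EFinD lee_fin exprS -/c; lra.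
move=> e0.
have /cvgrPdist_le/(_ e e0)[k _ /(_ k (leqnn k))] : ((3 / 4 : R) ^+ n)%R @[n --> \oo] --> (0 : R)%R.
  by apply: cvg_expr; rewrite ger0_norm ?divr_ge0//; lra.
rewrite /= sub0r normrN ger0_norm ?exprn_ge0 ?divr_ge0// => ke.
have [x x0 hx] := key k; exists x => // N; apply: (le_trans (hx N)).
by rewrite lee_fin.
Qed.

End supremum_finite.

(** * The integrated tail *)

Section renewal_measure.
Context (R : realType) (F : probability (measurableTypeR R) R).
Variable lam : {sigma_finite_measure set (measurableTypeR R) -> \bar R}.
Hypothesis nmomy : forall K : R, exists2 L, 0 < L & forall t, L <= t -> K <= nmom F t.
Hypothesis lam_le : forall c : R, 0 < c ->
  (lam `]0%R, c[%classic <= (mratio F c)%:E)%E.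
Local Open Scope ereal_scope.

Let r0 y := mratio_ge0 nmomy y.
Let mr := measurable_mratio nmomy.

(** [lam] stands for the Stieltjes measure of [t / m t]. *)
Definition itail (x : R) : \bar R :=
  \int[lam]_(t in `]0%R, +oo[%classic) F `](x + t)%R, +oo[%classic.

Let k (x t y : R) : \bar R := (0 < t)%R%:R%:E * below (y - x)%R t.

Let k0 x t y : 0 <= k x t y.
Proof. by rewrite mule_ge0 ?below_ge0// lee_fin. Qed.

Let mk x : measurable_fun setT
  (fun v : measurableTypeR R * measurableTypeR R => k x v.1 v.2).
Proof.
apply: emeasurable_funM; last exact: measurable_below2.
by apply: measurable_ltb; [exact: measurable_cst|exact: measurable_fst].
Qed.

Lemma lam_indic (x y : R) : lam `]0%R, (y - x)%R[%classic = \int[lam]_t k x t y.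
Proof.
rewrite -[X in lam X]setIT -integral_indic//; apply: eq_integral => t _.
rewrite /k belowE -EFinM -natrM mulnb indicE; congr (_%:R%:E).
by congr (nat_of_bool _); apply/idP/idP; rewrite inE/= in_itv.
Qed.

(** Exchanging the integrals shows that [itail] weighs the measure
    of [t < y - x] exactly as [jump_occ] weighs visits. *)
Lemma itailE x : itail x = \int[F]_y lam `]0%R, (y - x)%R[%classic.
Proof.
under eq_integral do rewrite lam_indic.
rewrite -(fubini_tonelli
  (fun v : measurableTypeR R * measurableTypeR R => k x v.1 v.2))//.
rewrite /itail integral_mkcond; apply: eq_integral => t _.
rewrite patchE /k/= ge0_integralZl//; last 2 first.
- exact: measurable_below_shift.
- by move=> y _; exact: below_ge0.
rewrite -exceed_below /exceed addrC; have [t0|t0] := ltP 0%R t.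
  by rewrite mul1e mem_set//= in_itv/= t0.
by rewrite mul0e memNset//= in_itv/= ltNge t0.
Qed.

Lemma measurable_lam x :
  measurable_fun [set: R] (fun y => lam `]0%R, (y - x)%R[%classic).
Proof.
under eq_fun do rewrite lam_indic.
by apply: (measurable_fun_fubini_tonelli_G
  (fun v : measurableTypeR R * measurableTypeR R => k x v.1 v.2)).
Qed.

Lemma lam_le_mratio (c : R) : lam `]0%R, c[%classic <= (mratio F c)%:E.
Proof.
have [c0|c0] := ltP 0%R c; first exact: lam_le.
rewrite (_ : `]0%R, c[%classic = set0) ?measure0 ?lee_fin//.
by apply/set_itv_ge; rewrite -leNgt bnd_simp.
Qed.

(** Integrate [occ_lower] over the size of the last jump, then let the horizon
    tend to infinity by monotone convergence. *)
Lemma itail_le_hit (x p : R) : (0 <= x)%R -> (p <= 1)%R ->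
  (forall N, hit F N x <= p%:E) -> (1 - p)%:E * itail x <= p%:E.
Proof.
move=> x0 p1 hp; have p0 : (0 <= p)%R by rewrite -lee_fin (le_trans _ (hp 0%N))// hit_ge0.
have q0 : (0 <= 1 - p)%R by rewrite subr_ge0.
pose g n (y : R) := (mratio F (y - x) / (1 + mratio F (y - x) / n.+1%:R))%R.
have n0 n : (0 < n.+1%:R :> R)%R by rewrite ltr0n.
have d0 n (r : R) : (0 <= r)%R -> (0 < 1 + r / n.+1%:R)%R.
  by move=> ?; rewrite ltr_pwDl// divr_ge0// ltW.
have g0 n y : 0 <= (g n y)%:E by rewrite lee_fin divr_ge0// ltW// d0.
have mg n : measurable_fun [set: R] (g n).
  apply: nondecreasing_measurable => // y y' yy'; rewrite /g.
  have rr : (mratio F (y - x) <= mratio F (y' - x))%R.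
    by apply: le_mratio => //; rewrite lerD2r.
  rewrite ler_pdivrMr ?d0// mulrAC ler_pdivlMr ?d0//.
  by rewrite !mulrDr !mulr1 !mulrA (mulrC (mratio F (y' - x))) lerD2r.
have mgE n : measurable_fun [set: R] (EFin \o g n) by exact/measurable_EFinP.
have gn n : (1 - p)%:E * \int[F]_y (g n y)%:E <= p%:E.
  apply: le_trans (hp n.+1); rewrite hit_jump// jump_occ -ge0_integralZl//; last exact: mgE.
  apply: ge0_le_integral => //.
  - by move=> y _; rewrite mule_ge0// lee_fin.
  - by apply: measurable_funeM; exact: mgE.
  - exact: measurable_occ_shift.
  move=> y _; rewrite subr0; have [xy|yx] := ltP x y; last first.
    by rewrite /g /mratio subr_gt0 ltNge yx/= mul0r mule0 occ_ge0.
  have t0 : (0 < y - x)%R by rewrite subr_gt0.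
  have := occ_lower t0 x0 (hp n.+1) (ltn0Sn n).
  rewrite (_ : x + (y - x) = y)%R; last by ring.
  move=> /(le_trans _); apply.
  rewrite -EFinM lee_fin /g /mratio t0; have m0 := nmom_gt0 nmomy t0.
  rewrite le_eqVlt; apply/orP; left; apply/eqP; field.
  have nn := n0 n; rewrite !gt_eqF// addr_gt0//.
  by rewrite mulr_gt0.
have lim : \int[F]_y (g n y)%:E @[n --> \oo] --> \int[F]_y (mratio F (y - x))%:E.
  have gl y : (g n y)%:E @[n --> \oo] --> (mratio F (y - x))%:E.
    apply: cvg_EFin; first by apply: nearW.
    rewrite -[X in _ --> X]divr1; apply: cvgM; first exact: cvg_cst.
    apply: cvgV; first exact: oner_neq0.
    rewrite -[X in _ --> X]addr0; apply: cvgD; first exact: cvg_cst.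
    rewrite -[X in _ --> X](mulr0 (mratio F (y - x))).
    by apply: cvgM; [exact: cvg_cst|exact: cvg_harmonic].
  rewrite (_ : \int[F]_y (mratio F (y - x))%:E =
      \int[F]_y limn (fun n => (g n y)%:E)); last first.
    by apply: eq_integral => y _; apply/esym/cvg_lim => //; exact: gl.
  apply: cvg_monotone_convergence => //.
  move=> y _ i j ij; rewrite lee_fin /g ler_wpM2l//.
  rewrite lef_pV2 ?posrE ?d0// lerD2l ler_wpM2l//.
  by rewrite lef_pV2 ?posrE ?ltr0n// ler_nat.
have gq : (1 - p)%:E * \int[F]_y (g n y)%:E @[n --> \oo] -->
    (1 - p)%:E * \int[F]_y (mratio F (y - x))%:E.
  exact: cvgeZl.
apply: (@le_trans _ _ ((1 - p)%:E * \int[F]_y (mratio F (y - x))%:E)).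
  apply: lee_wpmul2l => //; rewrite itailE; apply: ge0_le_integral => //.
  - exact: measurable_lam.
  - apply/measurable_EFinP; apply: measurableT_comp => //.
    exact: measurable_funB.
  - by move=> y _; exact: lam_le_mratio.
by apply: cvge_le gq; exact: nearW.
Qed.

Lemma measurable_tail_shift x :
  measurable_fun [set: R] (fun t => F `](x + t)%R, +oo[%classic).
Proof.
rewrite (_ : (fun _ => _) = exceed F x); first exact: measurable_exceed.
by apply/funext => t; rewrite /exceed addrC.
Qed.

Hypothesis lam_ge : exists2 K : R, (0 <= K)%R & forall c : R, (1 < c)%R ->
  (mratio F (c - 1) - K)%:E <= lam `]0%R, c[%classic.

Hypothesis long_tail : forall a e : R, (0 < a)%R -> (0 < e)%R ->
  exists2 x0 : R, (0 < x0)%R & forall x, (x0 <= x)%R ->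
  F `]x, +oo[%classic <= (1 + e)%:E * F `](x + a)%R, +oo[%classic.

Lemma lam_unbounded (q : R) :
  exists2 c : R, (1 < c)%R & q%:E <= lam `]0%R, c[%classic.
Proof.
have [K K0 HK] := lam_ge; have [c c0 Hc] := mratio_unbounded nmomy (q + K).
exists (1 + c)%R; first by rewrite ltrDl.
apply: le_trans (HK _ _); last by rewrite ltrDl.
by rewrite lee_fin [(1 + c)%R]addrC addrK lerBrDr Hc.
Qed.

(** [itail z] contains [Fbar (z + t)] for all [t < c], comparable with [Fbar z]
    by long-tailedness, with a total weight that is as large as desired. *)
Lemma tail_le_itail (q : R) : (0 <= q)%R ->
  exists2 z0 : R, (0 < z0)%R & forall z, (z0 <= z)%R ->
    q%:E * F `]z, +oo[%classic <= itail z.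
Proof.
move=> q0; have [c c1 hc] := lam_unbounded (2 * q).
have c0 : (0 < c)%R by rewrite (lt_trans ltr01).
have [z0 z00 hz] := long_tail c0 (ltr01).
exists z0 => // z /hz zz.
apply: (@le_trans _ _ ((2 * q)%:E * F `](z + c)%R, +oo[%classic)).
  by rewrite mulrC EFinM -muleA; apply: lee_wpmul2l; rewrite ?lee_fin.
apply: (@le_trans _ _ (\int[lam]_(t in `]0%R, c[%classic) F `](z + c)%R, +oo[%classic)).
  have -> : \int[lam]_(t in `]0%R, c[%classic) F `](z + c)%R, +oo[%classic =
      F `](z + c)%R, +oo[%classic * lam `]0%R, c[%classic.
    by apply: (integral_cst lam); exact: measurable_itv.
  by rewrite muleC; apply: lee_wpmul2l.
apply: (@le_trans _ _ (\int[lam]_(t in `]0%R, c[%classic) F `](z + t)%R, +oo[%classic)).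
  apply: ge0_le_integral => //.
  - exact: measurable_funTS (measurable_tail_shift z).
  - move=> t /=; rewrite in_itv/= => /andP[_ tc].
    apply: le_measure; rewrite ?inE//=.
    by apply: subset_itvr; rewrite bnd_simp lerD2l ltW.
apply: ge0_subset_integral => //.
- exact: measurable_funTS (measurable_tail_shift z).
- by apply: subset_itvl.
Qed.

Lemma itail_long (a e : R) : (0 < a)%R -> (0 < e)%R ->
  exists2 x0 : R, (0 < x0)%R & forall x, (x0 <= x)%R ->
  itail x <= (1 + e)%:E * itail (x + a)%R.
Proof.
move=> a0 e0; have [x0 x00 hx] := long_tail a0 e0.
exists x0 => // x xx; rewrite /itail -ge0_integralZl//; last 2 first.
- exact: measurable_funTS (measurable_tail_shift _).
- by rewrite lee_fin addr_ge0// ltW.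
apply: ge0_le_integral => //.
- exact: measurable_funTS (measurable_tail_shift _).
- by apply: measurable_funeM; exact: measurable_funTS (measurable_tail_shift _).
move=> t /=; rewrite in_itv/= andbT => t0; rewrite addrAC; apply: hx.
by rewrite (le_trans xx)// lerDl ltW.
Qed.

Hypothesis mratio_int : \int[F]_y (mratio F y)%:E < +oo.

(** The bound [2 / (1 - e) ^ 2 * mratio F (L + B)] of [occ_le] is rewritten in
    terms of [lam]; shifting the argument costs factors [1 + e] for large [L], and
    the constant [C] covers the other values of [L]. *)
Lemma occ_global (e : R) : (0 < e <= 10^-1)%R ->
  exists2 C : R, (0 <= C)%R & forall N L s, (0 < L)%R -> (0 <= s)%R ->
    occ F L N s <= C%:E + (2 * (1 + 5 * e))%:E * lam `]0%R, L[%classic.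
Proof.
move=> /andP[e0 e1]; have [L0 L00 Hp] := pmom_small nmomy mratio_int e0.
have [B B0 HB] := hit_vanish nmomy mratio_int e0.
have [K K0 HK] := lam_ge.
have [c c0 Hc] := mratio_unbounded nmomy (2 * (1 + e) * K / e).
have e01 : (0 < e < 1)%R by apply/andP; split; lra.
have e01' : (0 <= e < 1)%R by apply/andP; split; lra.
pose D := (2 / ((1 - e) * (1 - e)))%R.
have D0 : (0 < D)%R by rewrite divr_gt0// mulr_gt0//; lra.
pose L1 := Num.max L0 (Num.max (B / e) (Num.max (c + 1) (2 / e + 1)))%R.
have L10 : (0 < L1)%R by rewrite lt_max L00.
have occL N L s : (L1 <= L)%R -> (0 <= s)%R ->
    occ F L N s <= (D * mratio F (L + B))%:E.
  rewrite !ge_max => /andP[L0L _] s0.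
  apply: (@occ_le _ F nmomy e e L0) => //.
  - exact: lt_le_trans L0L.
  - exact: ltW.
  - by rewrite (le_trans L0L)// lerDl ltW.
exists (D * mratio F (L1 + B))%R; first by rewrite mulr_ge0// ltW.
move=> N L s Lp s0; have [LL1|L1L] := leP L L1.
  apply: (le_trans (le_occ _ _ _ LL1)); apply: (le_trans (occL _ _ _ (lexx _) s0)).
  by rewrite leeDl// mule_ge0// lee_fin mulr_ge0// addr_ge0// mulr_ge0// ltW.
apply: (le_trans (occL _ _ _ (ltW L1L) s0)).
move: (ltW L1L); rewrite !ge_max => /andP[_ /andP[BL /andP[cL eL]]].
apply: (@le_trans _ _ ((2 * (1 + 5 * e))%:E * lam `]0%R, L[%classic)); last first.
  by rewrite leeDr// lee_fin mulr_ge0// ltW.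
have L1' : (1 < L)%R by rewrite (lt_le_trans _ cL)// ltrDr.
apply: (@le_trans _ _ ((2 * (1 + 5 * e))%:E * (mratio F (L - 1) - K)%:E)); last first.
  by apply: lee_wpmul2l; [rewrite lee_fin mulr_ge0//; lra|exact: HK].
rewrite -EFinM lee_fin.
have r1 : (mratio F (L + B) <= (1 + e) * mratio F L)%R.
  have LB : (L <= L + B)%R by rewrite lerDl ltW.
  apply: (le_trans (mratio_scale nmomy Lp LB)); rewrite ler_wpM2r//.
  rewrite mulrDl divff ?gt_eqF// lerD2l ler_pdivrMr// mulrC -ler_pdivrMr//.
have Lm : (0 < L - 1)%R by rewrite subr_gt0.
have r2 : (mratio F L <= (1 + e / 2) * mratio F (L - 1))%R.
  have LL : (L - 1 <= L)%R by rewrite gerBl.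
  apply: (le_trans (mratio_scale nmomy Lm LL)); rewrite ler_wpM2r//.
  rewrite ler_pdivrMr// mulrDl mul1r -[leLHS](subrK 1%R) lerD2l.
  by move: eL; rewrite -lerBrDr ler_pdivrMr//; lra.
have r3 : (2 * (1 + e) * K <= e * mratio F (L - 1))%R.
  by rewrite -ler_pdivrMl// mulrC Hc// lerBrDr.
have r4 : (mratio F L <= (1 + e) * (mratio F (L - 1) - K))%R by lra.
apply: (@le_trans _ _ (D * ((1 + e) * ((1 + e) * (mratio F (L - 1) - K))))%R).
  rewrite ler_wpM2l ?(ltW D0)// (le_trans r1)// ler_wpM2l//; lra.
rewrite !mulrA ler_wpM2r//.
  rewrite -(pmulr_rge0 _ (_ : 0 < 1 + e)%R); last by lra.
  exact: le_trans r4.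
rewrite /D -!mulrA ler_wpM2l// ler_pdivrMl; last by rewrite mulr_gt0//; lra.
by nra.
Qed.

(** The constant [C] of [occ_global] contributes [C * Fbar z], which is
    negligible by [tail_le_itail]. *)
Lemma jump_le_itail (e : R) : (0 < e <= 10^-1)%R ->
  exists2 z0 : R, (0 < z0)%R & forall N z s, (z0 <= z)%R -> (0 <= s)%R ->
    jump F z N s <= (2 * (1 + 6 * e))%:E * itail z.
Proof.
move=> e01; have /andP[e0 _] := e01; have [C C0 HC] := occ_global e01.
have Ce0 : (0 <= C / (2 * e))%R by rewrite divr_ge0// mulr_ge0// ltW.
have [z0 z00 Hz] := tail_le_itail Ce0.
exists z0 => // N z s /Hz zz s0.
have q0 : (0 <= 2 * (1 + 5 * e))%R by lra.
have mb : measurable_fun [set: R] (fun y => below (y - z)%R 0%R).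
  exact: measurable_below_shift.
have b0 (y : R) : 0 <= below (y - z)%R 0%R by exact: below_ge0.
have ml := measurable_lam z.
have mCb : measurable_fun [set: R] (fun y => C%:E * below (y - z)%R 0%R).
  exact: measurable_funeM.
have mql : measurable_fun [set: R]
    (fun y => (2 * (1 + 5 * e))%:E * lam `]0%R, (y - z)%R[%classic).
  exact: measurable_funeM.
have Cb0 (y : R) : 0 <= C%:E * below (y - z)%R 0%R by rewrite mule_ge0.
have ql0 (y : R) : 0 <= (2 * (1 + 5 * e))%:E * lam `]0%R, (y - z)%R[%classic.
  by rewrite mule_ge0.
apply: (@le_trans _ _ (C%:E * F `]z, +oo[%classic + (2 * (1 + 5 * e))%:E * itail z)).
  have -> : F `]z, +oo[%classic = exceed F z 0%R by rewrite /exceed add0r.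
  rewrite jump_occ itailE exceed_below -!ge0_integralZl// -ge0_integralD//.
  apply: ge0_le_integral => //.
  - by move=> y _; exact: occ_ge0.
  - exact: measurable_occ_shift.
  - exact: emeasurable_funD.
  move=> y _; rewrite belowE subr_gt0; have [zy|yz] := ltP z y.
    by rewrite mule1; apply: HC => //; rewrite subr_gt0.
  by rewrite occ_le0 ?subr_le0// mule0 add0e.
rewrite (_ : 2 * (1 + 6 * e) = 2 * e + 2 * (1 + 5 * e))%R; last by ring.
rewrite [(2 * e + _)%:E]EFinD ge0_muleDl; [|by rewrite lee_fin; lra|by rewrite lee_fin].
apply: leeD => //.
rewrite (_ : C = 2 * e * (C / (2 * e)))%R; last by field; rewrite gt_eqF.
by rewrite EFinM -muleA; apply: lee_wpmul2l => //; rewrite lee_fin; lra.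
Qed.

End renewal_measure.

(** * Subexponential tails *)

Section tails.
Context (R : realType) (G : probability (measurableTypeR R) R).

Lemma tailE (x : R) : G `]x, +oo[%classic = (tail G x)%:E.
Proof.
rewrite /tail fineK// ge0_fin_numE//.
by rewrite (le_lt_trans (probability_le1 _ _)) ?ltry//; exact: measurable_itv.
Qed.

Lemma tail_ge0 x : 0 <= tail G x.
Proof. exact: fine_ge0. Qed.

Lemma le_tail x y : x <= y -> tail G y <= tail G x.
Proof.
move=> xy; rewrite -lee_fin -!tailE; apply: le_measure; rewrite ?inE//=.
by apply: subset_itvr; rewrite bnd_simp.
Qed.

Lemma tail_le1 x : tail G x <= 1.
Proof. by rewrite -lee_fin -tailE; apply: probability_le1; exact: measurable_itv. Qed.

Lemma measurable_tail : measurable_fun [set: R] (tail G).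
Proof. by apply: nonincreasing_measurable => // x y; exact: le_tail. Qed.

Lemma prob_tail_small (e : R) : 0 < e ->
  exists2 a, 0 < a & forall x, a <= x -> tail G x <= e.
Proof.
move=> e0; pose A (n : nat) : set R := `]n%:R, +oo[%classic.
have : (G \o A) n @[n --> \oo] --> G (\bigcap_n A n).
  apply: nonincreasing_cvg_mu => //.
  - by rewrite (le_lt_trans (probability_le1 _ _))// ?ltry//; exact: measurable_itv.
  - by move=> n; exact: measurable_itv.
  - by apply: bigcap_measurable => // n _; exact: measurable_itv.
  - move=> m n mn; apply/subsetPset => y; rewrite /A/= !in_itv/= !andbT.
    by apply: le_lt_trans; rewrite ler_nat.
have -> : \bigcap_n A n = set0.
  rewrite -subset0 => y /(_ (Num.bound `|y|) I).
  rewrite /A/= in_itv/= andbT ltNge => /negP; apply.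
  by rewrite (le_trans (ler_norm _))// ltW// archi_boundP.
rewrite measure0 => /fine_cvgP[_ /cvgrPdist_le/(_ e e0)[n _ /(_ n.+1 (leqnSn n))]].
rewrite /= sub0r normrN ger0_norm; last exact/fine_ge0.
move=> An; exists n.+1%:R => // x nx; exact: le_trans (le_tail nx) An.
Qed.

(** The probability that two independent variables of law [G] sum to more than
    [u], while one of them lies between [B] and [u - B']. *)
Definition middle (B B' u : R) : \bar R :=
  (\int[G]_b (((B < b) && (b <= u - B'))%:R * tail G (u - b))%:E)%E.

Lemma measurable_middle (B B' u : R) : measurable_fun [set: R]
  (fun b : R => ((((B < b) && (b <= u - B'))%:R * tail G (u - b))%:E : \bar R)).
Proof.
rewrite (_ : (fun _ => _) = (EFin \o (fun b => tail G (u - b))) \_ `]B, (u - B')]%classic).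
  apply: measurable_restr; first exact: measurable_itv.
  apply/measurable_EFinP; apply: measurableT_comp; first exact: measurable_tail.
  exact: measurable_funB.
apply/funext => b; rewrite patchE.
rewrite (_ : (b \in _) = ((B < b) && (b <= u - B'))); last first.
  by apply/idP/idP; rewrite inE/= in_itv.
by case: ifP; rewrite ?mul1r ?mul0r.
Qed.

Lemma convolutionE u :
  convolution G G `]u, +oo[%classic = (\int[G]_b (tail G (u - b))%:E)%E.
Proof.
rewrite /convolution /pushforward /product_measure1.
apply: eq_integral => b _; rewrite /= -tailE; congr (G _).
apply/seteqP; split => y; rewrite /xsection/= !in_itv/= !andbT.
  by rewrite inE/= in_itv/= andbT ltrBlDl.
by rewrite ltrBlDl => uby; rewrite inE/= in_itv/= andbT.
Qed.

Hypothesis Gsub : subexponential G.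

Lemma tail_gt0 x : 0 < tail G x.
Proof. by have [_ + _] := Gsub; apply. Qed.

(** The events that one of the two variables is large and the other at most [B]
    already have probability close to [2 * tail G u], which is all that
    subexponentiality allows. *)
Lemma middle_small (e : R) : 0 < e ->
  exists2 B, 0 < B & forall B', 0 <= B' -> exists2 u0, B + B' <= u0 &
    forall u, u0 <= u -> (middle B B' u <= (e * tail G u)%:E)%E.
Proof.
move=> e0; have [Gpos Gt0 Glim] := Gsub.
have e20 : 0 < e / 2 by rewrite divr_gt0.
have e40 : 0 < e / 4 by rewrite divr_gt0.
have [B B0 HB] := prob_tail_small e20.
exists B => // B' B'0.
have /cvgrPdist_le/(_ _ e40)[u1 [_ Hu1]] := Glim.
exists (Num.max (u1 + 1) (B + B')); first by rewrite le_max lexx orbT.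
move=> u; rewrite ge_max => /andP[uu uB].
have : `|1 - tail (convolution G G) u / (2 * tail G u)| <= e / 4.
  by apply: Hu1; rewrite (lt_le_trans _ uu)// ltrDl.
rewrite distrC ler_norml => /andP[_]; rewrite lerBlDr ler_pdivrMr; last first.
  by rewrite mulr_gt0.
move=> conv.
have mt : measurable_fun [set: R] (fun b => (tail G (u - b))%:E).
  apply/measurable_EFinP; apply: measurableT_comp; first exact: measurable_tail.
  exact: measurable_funB.
have convE : (\int[G]_b (tail G (u - b))%:E = (tail (convolution G G) u)%:E)%E.
  rewrite -convolutionE /tail fineK// convolutionE ge0_fin_numE; last first.
    by apply: integral_ge0 => b _; rewrite lee_fin tail_ge0.
  apply: (@le_lt_trans _ _ 1%E); last exact: ltry.
  rewrite -(integral_probc G 1); apply: ge0_le_integral => //.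
  - by move=> b _; rewrite lee_fin tail_ge0.
  - by move=> b _; rewrite lee_fin tail_le1.
pose f (b : R) : \bar R := (tail G u * \1_(`[0%R, B]%classic) b)%:E.
pose g (b : R) : \bar R := (\1_(`]u, +oo[%classic) b)%:E.
pose h (b : R) : \bar R := (((B < b) && (b <= u - B'))%:R * tail G (u - b))%:E.
have split_le (b : R) : (f b + g b + h b <= (tail G (u - b))%:E)%E.
  rewrite /f /g /h -!EFinD lee_fin !indicE.
  have -> : (b \in `[0%R, B]%classic) = (0 <= b <= B).
    by apply/idP/idP; rewrite inE/= in_itv.
  have -> : (b \in `]u, +oo[%classic) = (u < b).
    by apply/idP/idP; rewrite inE/= in_itv/= andbT.
  have tu0 := tail_ge0 (u - b).
  have [bB|Bb] := leP b B.
    have -> : (u < b) = false by apply/negbTE; rewrite -leNgt; lra.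
    rewrite andbT mul0r !addr0; have [b0|b0] := leP 0 b; last by rewrite mulr0.
    by rewrite mulr1 le_tail// gerBl.
  rewrite andbF mulr0 add0r; have [ub|bu] := ltP u b.
    have -> : (b <= u - B') = false by apply/negbTE; rewrite -ltNge; lra.
    rewrite mul0r addr0 -lee_fin -tailE -Gpos; apply: le_measure; rewrite ?inE//=.
    by apply: subset_itvr; rewrite bnd_simp subr_lt0.
  by rewrite add0r; case: (b <= u - B'); rewrite ?mul1r ?mul0r.
have f0 b : (0 <= f b)%E by rewrite lee_fin mulr_ge0 ?tail_ge0.
have g0 b : (0 <= g b)%E by rewrite lee_fin.
have h0 b : (0 <= h b)%E by rewrite lee_fin mulr_ge0 ?tail_ge0.
have mf : measurable_fun [set: R] f.
  by apply/measurable_EFinP; apply: measurable_funM => //.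
have mg : measurable_fun [set: R] g.
  by apply/measurable_EFinP; apply: measurable_indic; exact: measurable_itv.
have mh : measurable_fun [set: R] h by exact: measurable_middle.
have mfg : measurable_fun [set: R] (fun b => f b + g b)%E by exact: emeasurable_funD.
have fg0 b : (0 <= f b + g b)%E by rewrite adde_ge0.
have fgh : (\int[G]_b f b + \int[G]_b g b + middle B B' u <=
    (tail (convolution G G) u)%:E)%E.
  have -> : middle B B' u = (\int[G]_b h b)%E by [].
  rewrite -convE -!ge0_integralD//.
  have fgh0 b : (0 <= f b + g b + h b)%E by rewrite adde_ge0.
  have mfgh : measurable_fun [set: R] (fun b => f b + g b + h b)%E.
    exact: emeasurable_funD.
  exact: ge0_le_integral.
have gE : (\int[G]_b g b = (tail G u)%:E)%E.
  by rewrite -tailE -[X in G X]setIT -integral_indic.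
have G0B : (G `[0%R, B]%classic = (1 - tail G B)%:E)%E.
  have : (G `[0%R, B]%classic + G `]B, +oo[%classic = 1)%E.
    rewrite -Gpos -measureU//; last first.
      by apply/seteqP; split => // y /=; rewrite !in_itv/= andbT => -[]; lra.
    congr (G _); apply/seteqP; split => y /=; rewrite !in_itv/= !andbT.
      by case=> [/andP[]//|]; lra.
    by move=> ->; have [yB|By] := leP y B; [left|right].
  rewrite tailE EFinB => <-; rewrite addeK//.
have fE : (\int[G]_b f b = (tail G u * (1 - tail G B))%:E)%E.
  under eq_integral do rewrite /f EFinM.
  rewrite ge0_integralZl//; last 2 first.
  - by apply/measurable_EFinP; apply: measurable_indic; exact: measurable_itv.
  - by rewrite lee_fin tail_ge0.
  by rewrite EFinM -G0B -[X in G X]setIT -integral_indic.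
have tB : tail G B <= e / 2 by exact: HB.
move: fgh; rewrite fE gE -EFinD -leeBrDl// => /le_trans; apply.
rewrite -EFinB lee_fin; have := tail_ge0 u; nra.
Qed.

End tails.

(** * Upper bound for the supremum *)

Section upper.
Context (R : realType) (F G : probability (measurableTypeR R) R).
Hypothesis Gsub : subexponential G.
Hypothesis G_long : forall a e : R, 0 < a -> 0 < e ->
  exists2 x0 : R, 0 < x0 & forall x, x0 <= x ->
  tail G x <= (1 + e) * tail G (x + a).
Hypothesis jump_G : forall e : R, 0 < e <= 10^-1 ->
  exists2 z0 : R, 0 < z0 & forall N z s, z0 <= z -> 0 <= s ->
    (jump F z N s <= (2 * (1 + 6 * e) * tail G z)%:E)%E.
Hypothesis hit_to0 : forall e : R, 0 < e ->
  exists2 B : R, 0 < B & forall N, (hit F N B <= e%:E)%E.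

(** Cut at the first passage over [A]; the overshoot exceeds [z] with probability
    at most [c * tail G z] and at most [dl]. Up to the distance [u - B] the tail of
    the remaining supremum is at most [C * tail G], so that it may be replaced by
    an independent variable [b] of law [G]: either [b <= u - B'], and the overshoot
    is large as well, or [b > u - B'] and only its total mass [dl] counts. *)
Lemma hit_one_step (A B B' u c dl C : R) N :
  0 <= A -> 0 <= B -> 0 <= B' -> 0 <= c -> 0 <= dl -> 0 <= C -> B + B' <= u ->
  (forall z s, B' <= z -> 0 <= s -> (jump F z N s <= (c * tail G z)%:E)%E) ->
  (hit F N A <= dl%:E)%E ->
  (forall w, 0 <= w <= u -> (hit F N w <= (C * tail G w)%:E)%E) ->
  (hit F N (A + u) <= (c * tail G (u - B))%:E +
    C%:E * (c%:E * middle G B B' u + dl%:E * (tail G (u - B'))%:E))%E.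
Proof.
move=> A0 B0 B'0 c0 dl0 C0 Bu HJ HA HC.
have u0 : 0 <= u by rewrite (le_trans _ Bu)// addr_ge0.
have mind (a : R) : measurable_fun [set: R] (fun b : R => ((a < b)%R%:R%:E : \bar R)).
  exact: measurable_ltb.
have mind' (a : R) : measurable_fun [set: R] (fun b : R => ((a < b)%R%:R : R)).
  by apply/measurable_EFinP; exact: mind.
have GE (a : R) : (\int[G]_b (a < b)%R%:R%:E = (tail G a)%:E :> \bar R)%E.
  rewrite -tailE -[X in G X]setIT -integral_indic//; apply: eq_integral => b _.
  rewrite indicE; have -> // : (b \in `]a, +oo[%classic) = (a < b).
  by apply/idP/idP; rewrite inE/= in_itv/= andbT.
apply: (@le_trans _ _ (jump F (u - B) N A + \int[G]_b ((C * (B < b)%R%:R)%:E *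
    jump F (Num.max (u - b)%R 0%R) N A))%E).
  apply: (@hit_decomp _ F _ _ G (fun b => Num.max (u - b) 0)
    (fun b => C * (B < b)%R%:R) (u - B) u N) => //.
  - by apply: measurable_maxr => //; exact: measurable_funB.
  - by apply: measurable_funM => //; exact: mind'.
  - by move=> b; rewrite mulr_ge0.
  move=> z z0; have [uBz|zuB] := ltP (u - B) z.
    rewrite (le_trans (hit_le1 _ _ _))// leeDl//.
    by apply: integral_ge0 => b _; rewrite -EFinM lee_fin !mulr_ge0.
  have uz : 0 <= u - z <= u by apply/andP; split; lra.
  rewrite add0e; apply: (le_trans (HC _ uz)).
  rewrite EFinM -GE -ge0_integralZl//; last exact: mind.
  apply: ge0_le_integral => //.
  - by move=> b _; rewrite -EFinM lee_fin mulr_ge0.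
  - by apply: measurable_funeM; exact: mind.
  - apply: emeasurable_funM; first by apply/measurable_EFinP; apply: measurable_funM => //; exact: mind'.
    apply: measurable_ltb => //.
    by apply: measurable_maxr => //; exact: measurable_funB.
  move=> b _; rewrite -!EFinM lee_fin -mulrA ler_wpM2l//.
  have [uzb|//] := ltP (u - z) b; last by rewrite mulr_ge0.
  have -> : B < b by lra.
  have -> : Num.max (u - b) 0 < z by rewrite gt_max z0 andbT; lra.
  by rewrite mulr1.
have mj : measurable_fun [set: R] (fun b => jump F (Num.max (u - b) 0) N A).
  rewrite (_ : (fun _ => _) = (fun z : R => jump F z N A) \o (fun b => Num.max (u - b) 0))//.
  apply: measurableT_comp; last first.
    by apply: measurable_maxr => //; exact: measurable_funB.
  exact: measurable_jump.
apply: leeD; first by apply: HJ => //; lra.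
rewrite -GE /middle.
have mm := measurable_middle G B B' u.
have m0 b : (0 <= (((B < b) && (b <= u - B'))%:R * tail G (u - b))%:E)%E.
  by rewrite lee_fin mulr_ge0 ?tail_ge0.
have cm0 b : (0 <= c%:E * (((B < b) && (b <= u - B'))%:R * tail G (u - b))%:E)%E.
  by rewrite mule_ge0.
have dm0 b : (0 <= dl%:E * (u - B' < b)%R%:R%:E)%E.
  by rewrite mule_ge0// lee_fin.
have mcm : measurable_fun [set: R] (fun b : R => c%:E *
    (((B < b) && (b <= u - B'))%:R * tail G (u - b))%:E)%E.
  exact: measurable_funeM.
have mdm : measurable_fun [set: R] (fun b : R => dl%:E * (u - B' < b)%R%:R%:E)%E.
  by apply: measurable_funeM; exact: mind.
have mD : measurable_fun [set: R] (fun b : R => c%:E *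
    (((B < b) && (b <= u - B'))%:R * tail G (u - b))%:E +
    dl%:E * (u - B' < b)%R%:R%:E)%E.
  exact: emeasurable_funD.
have D0 b : (0 <= c%:E * (((B < b) && (b <= u - B'))%:R * tail G (u - b))%:E +
    dl%:E * (u - B' < b)%R%:R%:E)%E.
  exact: adde_ge0.
rewrite -!ge0_integralZl//; last exact: mind.
rewrite -ge0_integralD// -ge0_integralZl//.
have CB0 b : (0 <= (C * (B < b)%R%:R)%:E)%E by rewrite lee_fin mulr_ge0.
apply: ge0_le_integral => //.
- by move=> b _; rewrite mule_ge0// jump_ge0.
- apply: emeasurable_funM => //.
  by apply/measurable_EFinP; apply: measurable_funM => //; exact: mind'.
- exact: measurable_funeM.
move=> b _; rewrite EFinM -muleA; apply: lee_wpmul2l => //.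
move: (D0 b); have [Bb|bB] := ltP B b; last by rewrite mul0e.
move=> _.
rewrite mul1e; have [ubB|bub] := ltP (u - B') b.
  rewrite mul0r mule0 add0e mule1; apply: le_trans HA.
  by apply: jump_le_hit => //; rewrite le_max lexx orbT.
rewrite mul1r mule0 adde0 -EFinM.
have ub : B' <= u - b by lra.
by rewrite max_l ?HJ// (le_trans B'0).
Qed.

(** As [C] enters with the small factor [5 * e], this inequality first yields a
    finite constant and then, for small [e], the constant 2. *)
Lemma hit_step (e : R) : 0 < e <= 10^-1 ->
  exists A x1 : R, [/\ 0 < A, A <= x1 & forall N C x, 0 <= C -> x1 <= x ->
    (forall w, 0 <= w <= x - A -> (hit F N w <= (C * tail G w)%:E)%E) ->
    (hit F N x <= ((2 + 20 * e + 5 * e * C) * tail G x)%:E)%E].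
Proof.
move=> e01; have /andP[e0 e1] := e01.
have [B' B'0 HJ] := jump_G e01.
have [A A0 HA] := hit_to0 e0.
have [B B0 HB] := middle_small Gsub e0.
have [u0 Bu0 Hm] := HB B' (ltW B'0).
have [yA yA0 HyA] := G_long A0 e0.
have [yB yB0 HyB] := G_long B0 e0.
have [yB' yB'0 HyB'] := G_long B'0 e0.
pose x1 := A + (Num.max u0 (Num.max yA (Num.max (yB + B) (yB' + B')))).
exists A, x1; split => //.
  by rewrite lerDl le_max (le_trans _ Bu0)// addr_ge0// ltW.
move=> N C x C0 x1x HC; pose u := x - A.
have xE : x = A + u by rewrite /u; lra.
have : x1 - A <= u by rewrite /u lerD2r.
rewrite /x1 addrAC subrr add0r !ge_max => /andP[u0u /andP[yAu /andP[yBu yB'u]]].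
pose c := 2 * (1 + 6 * e).
have c0 : 0 <= c by rewrite /c; lra.
have tA := HyA _ yAu.
have tB : tail G (u - B) <= (1 + e) * tail G u.
  by rewrite -[in leRHS](subrK B u) HyB// lerBrDr.
have tB' : tail G (u - B') <= (1 + e) * tail G u.
  by rewrite -[in leRHS](subrK B' u) HyB'// lerBrDr.
have uBB : B + B' <= u by exact: le_trans u0u.
rewrite xE; apply: (le_trans (hit_one_step (ltW A0) (ltW B0) (ltW B'0) c0 (ltW e0)
  C0 uBB (HJ N) (HA N) HC)).
apply: (@le_trans _ _ ((c * tail G (u - B))%:E +
    C%:E * (c%:E * (e * tail G u)%:E + e%:E * (tail G (u - B'))%:E))%E).
  apply: leeD => //; apply: lee_wpmul2l => //; apply: leeD => //.
  by apply: lee_wpmul2l => //; exact: Hm.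
rewrite -!(EFinM, EFinD) lee_fin.
rewrite [u + A]addrC in tA.
set T := tail G (A + u) in tA *.
have T0 : 0 <= T := tail_ge0 G _.
have tuT : (1 + e) * tail G u <= (1 + e) * ((1 + e) * T) by rewrite ler_wpM2l//; lra.
have h1 : c * tail G (u - B) <= c * ((1 + e) * ((1 + e) * T)).
  by rewrite ler_wpM2l// (le_trans tB).
have h2 : c * (e * tail G u) + e * tail G (u - B') <= 5 * e * T.
  have h21 : c * e * tail G u <= c * e * ((1 + e) * T) by rewrite ler_wpM2l// mulr_ge0// ltW.
  have h22 : e * tail G (u - B') <= e * ((1 + e) * ((1 + e) * T)).
    by apply: ler_wpM2l; [exact: ltW|exact: le_trans tB' tuT].
  have h23 : c * ((1 + e) * T) + (1 + e) * ((1 + e) * T) <= 5 * T.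
    rewrite !mulrA -mulrDl ler_wpM2r// /c; nra.
  have := ler_wpM2l (ltW e0) h23; nra.
have h3 : c * ((1 + e) * ((1 + e) * T)) <= (2 + 20 * e) * T.
  by rewrite !mulrA ler_wpM2r// /c; nra.
have := ler_wpM2l C0 h2; nra.
Qed.

(** The uniform constant [C] comes from [hit_step] with [e = 1/10], where the
    factor is [4 + C / 2 <= C], by induction on intervals of length [A]. A second
    application, with [e'] small compared with [1 / C], gives the claim. *)
Lemma hit_le_tail (e : R) : 0 < e -> exists2 x1 : R, 0 < x1 & forall N x, x1 <= x ->
  (hit F N x <= ((2 + e) * tail G x)%:E)%E.
Proof.
move=> e0; have h10 : 0 < (10^-1 : R) <= 10^-1 by rewrite invr_gt0 ltr0n lexx.
have [A [x1 [A0 Ax1 step]]] := hit_step h10.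
pose C := Num.max 8 (tail G x1)^-1.
have C8 : 8 <= C by rewrite le_max lexx.
have C0 : 0 <= C by rewrite (le_trans _ C8).
have unif N k x : 0 <= x -> x <= x1 + k%:R * A -> (hit F N x <= (C * tail G x)%:E)%E.
  elim: k x => [|k IH] x x0.
    rewrite mul0r addr0 => xx1; apply: (le_trans (hit_le1 _ _ _)).
    rewrite lee_fin -(mulVf (lt0r_neq0 (tail_gt0 Gsub x1))).
    apply: ler_pM; rewrite ?invr_ge0 ?tail_ge0//; last exact: le_tail.
    by rewrite le_max lexx orbT.
  rewrite -natr1 => xk; have [xx1|x1x] := leP x (x1 + k%:R * A); first exact: IH.
  have x1x' : x1 <= x by rewrite (le_trans _ (ltW x1x))// lerDl mulr_ge0// ltW.
  have := @step N C x C0 x1x'.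
  move=> /(_ _)/le_trans; apply.
    by move=> w /andP[w0 wx]; apply: IH => //; lra.
  rewrite lee_fin ler_wpM2r ?tail_ge0//; lra.
have bound N x : 0 <= x -> (hit F N x <= (C * tail G x)%:E)%E.
  move=> x0; apply: (unif N (Num.bound (x / A))) => //.
  have := archi_boundP (divr_ge0 x0 (ltW A0)).
  by rewrite ltr_pdivrMr// => h; lra.
pose e' := Num.min 10^-1 (e / (20 + 5 * C)).
have d0 : 0 < 20 + 5 * C by lra.
have e'0 : 0 < e' <= 10^-1.
  by rewrite lt_min invr_gt0 ltr0n divr_gt0//= ge_min lexx.
have [A' [x1' [A'0 Ax1' step']]] := hit_step e'0.
exists x1'; first exact: lt_le_trans Ax1'.
move=> N x xx; apply: (le_trans (step' N C x C0 xx _)).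
  by move=> w /andP[w0 _]; exact: bound.
rewrite lee_fin ler_wpM2r ?tail_ge0//.
have : e' <= e / (20 + 5 * C) by rewrite ge_min lexx orbT.
by rewrite ler_pdivlMr//; lra.
Qed.

End upper.

(** * The random walk and its running maximum *)

Section joint_law.
Context d (T : measurableType d) (R : realType) (P : probability T R).
Local Open Scope ereal_scope.

(** Independence of [X] and [Y] conditionally on [E], from rectangles to all
    measurable sets of the plane. *)
Lemma joint_law (X Y : T -> R) (F1 F2 : probability (measurableTypeR R) R)
    (E : set T) :
  measurable_fun [set: T] X -> measurable_fun [set: T] Y -> measurable E ->
  (forall A B : set (measurableTypeR R), measurable A -> measurable B ->
    P (E `&` (X @^-1` A `&` Y @^-1` B)) = P E * (F1 A * F2 B)) ->
  forall Z : set (measurableTypeR R * measurableTypeR R), measurable Z ->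
    P (E `&` [set w | Z (X w, Y w)]) = P E * (F1 \x F2) Z.
Proof.
move=> mX mY mE EXY Z mZ.
have mXY : measurable_fun setT (fun w => (X w, Y w) : measurableTypeR R * measurableTypeR R).
  by apply/measurable_fun_pairP; split.
pose f w : measurableTypeR R * measurableTypeR R := (X w, Y w).
have mEZ W : measurable W -> measurable (E `&` f @^-1` W).
  move=> mW; apply: measurableI => //.
  by rewrite -[X in measurable X]setTI; exact: mXY.
have PE_fin : P E \is a fin_num.
  by rewrite ge0_fin_numE ?(le_lt_trans (probability_le1 _ _)) ?ltry.
have [PE0|PE0] := eqVneq (P E) 0.
  rewrite PE0 mul0e; apply/eqP; rewrite eq_le measure_ge0 andbT -PE0.
  by apply: le_measure; rewrite ?inE//; exact: mEZ.
have [p PEp] : exists p, P E = p%:E by exists (fine (P E)); rewrite fineK.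
have p0 : (0 < p)%R by rewrite -lte_fin -PEp lt0e PE0 measure_ge0.
have ip0 : (0 <= p^-1)%R by rewrite invr_ge0 ltW.
have key := @product_measure_unique _ _ _ _ _ F1 F2
  (mscale (NngNum ip0) (pushforward (mrestr P mE) f)) _ Z mZ.
rewrite (key mXY) => [|A B mA mB].
  rewrite /mscale /= /pushforward /mrestr muleA PEp -EFinM.
  by rewrite divff ?gt_eqF// mul1e setIC.
rewrite /= /mscale /= /pushforward /mrestr /= setIC.
rewrite (_ : _ @^-1` _ = X @^-1` A `&` Y @^-1` B); last by apply/seteqP; split.
by rewrite EXY// muleA PEp -EFinM mulVf ?gt_eqF// mul1e.
Qed.

End joint_law.

Section random_walk.
Context d (T : measurableType d) (R : realType) (P : probability T R).
Variable F : probability (measurableTypeR R) R.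
Variable xi : nat -> {RV P >-> R}.
Hypothesis xi_indep : independent_RVs xi.
Hypothesis xi_law : forall (k : nat) (B : set R), measurable B ->
  P (xi k @^-1` B) = F B.

(** The maximum of the partial sums of [xi k.+1, ..., xi (k + n)], computed from
    its first step as in the definition of [hit]. *)
Fixpoint runmax (k n : nat) (w : T) : R :=
  if n is n'.+1 then Num.max 0 (xi k.+1 w + runmax k.+1 n' w) else 0.

Lemma runmax_ge0 k n w : 0 <= runmax k n w.
Proof. by case: n => //= n; rewrite le_max lexx. Qed.

Lemma measurable_runmax k n : measurable_fun [set: T] (runmax k n).
Proof.
elim: n k => [|n IH] k /=; first exact: measurable_cst.
apply: measurable_maxr => //; apply: measurable_funD => //.
Qed.

Lemma runmax_gt k n w x : 0 <= x ->
  (x < runmax k n w) <-> exists2 j, (j <= n)%N & x < \sum_(k.+1 <= i < k.+1 + j) xi i w.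
Proof.
elim: n k x => [|n IH] k x x0 /=.
  split; first by rewrite ltNge x0.
  by case=> j; rewrite leqn0 => /eqP->; rewrite addn0 big_geq// ltNge x0.
rewrite lt_max ltNge x0 /=; split.
  have [xxi|xix] := ltP x (xi k.+1 w).
    by move=> _; exists 1%N => //; rewrite addn1 big_nat1.
  rewrite -ltrBlDl => /IH; rewrite subr_ge0 => /(_ xix)[j jn xj].
  exists j.+1 => //; rewrite addnS -addSn big_ltn ?leq_addr//.
  by rewrite -ltrBlDl.
case=> -[|j] jn; first by rewrite addn0 big_geq// => /(le_lt_trans x0); rewrite ltxx.
rewrite addnS -addSn big_ltn ?leq_addr// => xj.
have [xxi|xix] := ltP x (xi k.+1 w).
  by rewrite (lt_le_trans xxi)// lerDl runmax_ge0.
rewrite -ltrBlDl; apply/IH; first by rewrite subr_ge0.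
by exists j => //; rewrite ltrBlDl.
Qed.

(** The law is taken on the measurable space on which [F] lives, so that product
    measures with [F] can be formed. *)
Lemma runmax_law k n : exists Q : probability (measurableTypeR R) R,
  forall C, Q C = P (runmax k n @^-1` C).
Proof.
have mV : @measurable_fun _ _ T (measurableTypeR R) [set: T] (runmax k n).
  exact: measurable_runmax.
pose V : {mfun T >-> measurableTypeR R} :=
  HB.pack (runmax k n) (isMeasurableFun.Build _ _ _ _ _ mV).
by exists (distribution P V).
Qed.

Definition cylinder (J : {fset nat}) (B : nat -> set R) : set T :=
  \bigcap_(k in [set` J]) (xi k @^-1` B k).

Lemma measurable_cylinder J B : (forall j, measurable (B j)) -> measurable (cylinder J B).
Proof.
move=> mB; apply: fin_bigcap_measurable => // j _.
by rewrite -[X in measurable X]setTI; exact: (measurable_funP (xi j)).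
Qed.

Lemma cylinder0 B : cylinder fset0 B = setT.
Proof. by apply/seteqP; split => // w _ j /=; rewrite in_fset0. Qed.

Lemma cylinderU1 J B k A : k \notin J ->
  cylinder (k |` J)%fset (fun j => if j == k then A else B j) =
  cylinder J B `&` xi k @^-1` A.
Proof.
move=> kJ; apply/seteqP; split => w /=.
  move=> H; split; last by have := H k; rewrite eqxx; apply; rewrite /= fset1U1.
  move=> j /= jJ; have := H j; case: eqP => [jk|_]; first by rewrite jk (negbTE kJ) in jJ.
  by apply; rewrite /= in_fset1U jJ orbT.
move=> [H wA] j /=; rewrite in_fset1U; case: eqP => [->//|_ /= jJ].
exact: H.
Qed.

Lemma cylinder_prob J B k A : k \notin J -> (forall j, measurable (B j)) ->
  measurable A ->
  P (cylinder J B `&` xi k @^-1` A) = (P (cylinder J B) * F A)%E.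
Proof.
move=> kJ mB mA; rewrite -cylinderU1// xi_indep; last by move=> j; case: ifP.
rewrite big_fsetU1//= eqxx xi_law// muleC xi_indep//; congr (_ * _)%E.
apply: eq_big_seq => j jJ; case: eqP => // jk.
by rewrite -jk jJ in kJ.
Qed.

(** The recursion of [runmax] consumes the variable [xi k.+1]; the statement is
    therefore proved jointly for all finite families of earlier variables. *)
Lemma runmax_indep n k J B C : (forall j, j \in J -> (j <= k)%N) ->
  (forall j, measurable (B j)) -> measurable C ->
  P (cylinder J B `&` runmax k n @^-1` C) =
  (P (cylinder J B) * P (runmax k n @^-1` C))%E.
Proof.
elim: n k J B C => [|n IH] k J B C Jk mB mC.
  have [C0|C0] := pselect (C 0).
    rewrite (_ : runmax k 0 @^-1` C = setT) ?setIT ?probability_setT ?mule1//.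
    by apply/seteqP; split.
  by rewrite (_ : runmax k 0 @^-1` C = set0) ?setI0 ?measure0 ?mule0//; apply/seteqP; split.
have [Q HQ] := runmax_law k.+1 n.
pose Z : set (measurableTypeR R * measurableTypeR R) :=
  (fun v => Num.max 0 (v.1 + v.2)) @^-1` C.
have mZ : measurable Z.
  rewrite -[Z]setTI; have : measurable_fun setT
      (fun v : measurableTypeR R * measurableTypeR R => Num.max 0 (v.1 + v.2) : R).
    by apply: measurable_maxr => //; apply: measurable_funD.
  by apply.
have pair J' B' : (forall j, j \in J' -> (j <= k)%N) -> (forall j, measurable (B' j)) ->
    P (cylinder J' B' `&` runmax k n.+1 @^-1` C) = (P (cylinder J' B') * (F \x Q) Z)%E.
  move=> J'k mB'; apply: (@joint_law _ _ _ P (xi k.+1) (runmax k.+1 n) F Q) => //.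
  - exact: measurable_runmax.
  - exact: measurable_cylinder.
  move=> A D mA mD; have kJ' : k.+1 \notin J'.
    by apply/negP => /J'k; rewrite ltnn.
  rewrite setIA -cylinderU1// IH//; last 2 first.
  - by move=> j; rewrite in_fset1U => /predU1P[->//|/J'k/leqW].
  - by move=> j; case: ifP.
  by rewrite cylinderU1// cylinder_prob// -HQ muleA.
rewrite pair//; congr (_ * _)%E.
have := pair fset0 B; rewrite cylinder0 setTI probability_setT mul1e => -> //.
Qed.

Lemma runmax_hit n k x : 0 <= x -> P (runmax k n @^-1` `]x, +oo[%classic) = hit F n x.
Proof.
elim: n k x => [|n IH] k x x0.
  rewrite (_ : _ @^-1` _ = set0) ?measure0 /= ?ltNge ?x0//.
  by apply/seteqP; split => // w /=; rewrite in_itv/= andbT ltNge x0.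
have [Q HQ] := runmax_law k.+1 n.
pose Z : set (measurableTypeR R * measurableTypeR R) := [set v | x < v.1 + v.2].
have mZ : measurable Z.
  rewrite -[Z]setTI (_ : Z = (fun v => v.1 + v.2) @^-1` `]x, +oo[%classic).
    have : measurable_fun setT
      (fun v : measurableTypeR R * measurableTypeR R => (v.1 + v.2) : R).
      exact: measurable_funD.
    by apply; rewrite ?measurable_itv//; exact: measurable_itv.
  by apply/seteqP; split => v /=; rewrite in_itv/= andbT.
have E : P (setT `&` [set w | Z (xi k.+1 w, runmax k.+1 n w)]) =
    (P [set: T] * (F \x Q) Z)%E.
  apply: (@joint_law _ _ _ P (xi k.+1) (runmax k.+1 n) F Q) => //.
    exact: measurable_runmax.
  move=> A D mA mD; rewrite setTI probability_setT mul1e.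
  pose B (j : nat) : set R := if j == k.+1 then A else setT.
  rewrite -[xi k.+1 @^-1` A]setTI -(cylinder0 (fun=> setT)) -cylinderU1 ?in_fset0//.
  rewrite runmax_indep//.
  - by rewrite cylinderU1 ?in_fset0// cylinder0 setTI xi_law// HQ.
  - by move=> j; rewrite in_fset1U in_fset0 orbF => /eqP ->.
  - by move=> j; case: ifP.
rewrite (_ : _ @^-1` _ = setT `&` [set w | Z (xi k.+1 w, runmax k.+1 n w)]); last first.
  rewrite setTI; apply/seteqP; split => w /=; rewrite in_itv/= andbT /Z/=.
    by rewrite lt_max ltNge x0.
  by rewrite lt_max => ->; rewrite orbT.
rewrite E probability_setT mul1e hitS// /product_measure1; apply: eq_integral => y _ /=.
have -> : xsection Z y = `]x - y, +oo[%classic.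
  by apply/seteqP; split => v; rewrite /xsection/= in_itv/= andbT inE/= ltrBlDl.
rewrite HQ; have [xy0|xy0] := leP 0 (x - y); first exact: IH.
rewrite hit_lt0// -(@probability_setT _ _ _ P); congr (P _).
apply/seteqP; split => // w _ /=; rewrite in_itv/= andbT.
by rewrite (lt_le_trans xy0)// runmax_ge0.
Qed.

Definition partial_sum (n : nat) (w : T) : R := \sum_(1 <= k < n.+1) xi k w.
Definition supremum (w : T) : \bar R := ereal_sup [set (partial_sum n w)%:E | n in [set: nat]].

Lemma supremum_runmax x : 0 <= x ->
  [set w | (x%:E < supremum w)%E] = \bigcup_n (runmax 0 n @^-1` `]x, +oo[%classic).
Proof.
move=> x0; apply/seteqP; split => w /=.
  move=> /ereal_sup_gt[_ [n _ <-]]; rewrite lte_fin => xn.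
  exists n => //=; rewrite in_itv/= andbT; apply/runmax_gt => //.
  by exists n.
case=> n _ /=; rewrite in_itv/= andbT => /runmax_gt -/(_ x0)[j jn xj].
by apply: lt_le_trans (ereal_sup_ubound _); last by exists j.
Qed.

Lemma measurable_supremum_gt x : 0 <= x ->
  measurable [set w | (x%:E < supremum w)%E].
Proof.
move=> x0; rewrite supremum_runmax//; apply: bigcup_measurable => n _.
by rewrite -[X in measurable X]setTI; apply: measurable_runmax.
Qed.

Lemma supremum_cvg x : 0 <= x ->
  hit F n x @[n --> \oo] --> P [set w | (x%:E < supremum w)%E].
Proof.
move=> x0; rewrite supremum_runmax//.
have mV n : measurable (runmax 0 n @^-1` `]x, +oo[%classic).
  rewrite -[X in measurable X]setTI; apply: measurable_runmax => //.
rewrite (_ : (fun n => hit F n x) = P \o (fun n => runmax 0 n @^-1` `]x, +oo[%classic)).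
  apply: nondecreasing_cvg_mu => //; first exact: bigcup_measurable.
  move=> m n mn; apply/subsetPset => w /=; rewrite !in_itv/= !andbT.
  move=> /runmax_gt -/(_ x0)[j jm xj]; apply/runmax_gt => //.
  by exists j => //; exact: leq_trans mn.
by apply/funext => n /=; rewrite runmax_hit.
Qed.

Lemma hit_le_supremum n x : 0 <= x -> (hit F n x <= P [set w | (x%:E < supremum w)%E])%E.
Proof.
move=> x0; apply: (@cvge_ge _ _ _ _ _ _ _ _ (supremum_cvg x0)).
by exists n => // m /= nm; exact: hit_nd.
Qed.

Lemma supremum_le x c : 0 <= x -> (forall n, hit F n x <= c)%E ->
  (P [set w | (x%:E < supremum w)%E] <= c)%E.
Proof.
move=> x0 hc; apply: cvge_le (supremum_cvg x0).
exact: nearW.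
Qed.

End random_walk.

(** * Proof of the theorem *)

Lemma lebesgue_stieltjes_itvoc (R : realType) (f : cumulative R R) (a b : R) :
  a <= b -> lebesgue_stieltjes_measure f `]a, b]%classic = (f b - f a)%:E.
Proof.
move=> ab; rewrite /lebesgue_stieltjes_measure /measure_extension.
rewrite measurable_mu_extE/=; last exact: is_ocitv.
by rewrite wlength_itv_bnd.
Qed.

Section law_of_steps.
Context d (T : measurableType d) (R : realType) (P : probability T R).
Variables (F : probability (measurableTypeR R) R) (X : {RV P >-> R}).
Hypothesis X_law : forall B : set R, measurable B -> P (X @^-1` B) = F B.

Lemma integral_law (f : R -> \bar R) : measurable_fun [set: R] f ->
  (forall y, (0 <= f y)%E) -> (\int[F]_y f y = \int[P]_w f (X w))%E.
Proof.
move=> mf f0.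
have mX : @measurable_fun _ _ T (measurableTypeR R) [set: T] X.
  exact: (measurable_funP X).
rewrite -[RHS](@ge0_integral_pushforward _ _ _ _ _ _ mX P setT f)//.
by apply: eq_measure_integral => A mA _; rewrite /= /pushforward X_law.
Qed.

(** Only the law of the generic variable matters. *)
Lemma neg_trunc_meanE t : 0 <= t -> neg_trunc_mean X t = nmom F t.
Proof.
move=> t0; rewrite /neg_trunc_mean /nmom unlock integral_law//.
- by apply/measurable_EFinP; exact: measurable_npart.
- by move=> y; rewrite lee_fin npart_ge0.
Qed.

Lemma ratio_fun_mratio t : 0 < t -> ratio_fun X t = mratio F t.
Proof. by move=> t0; rewrite /ratio_fun /mratio t0 neg_trunc_meanE// ltW. Qed.

Lemma nmom_unbounded : ('E_P[X^\-] = +oo)%E ->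
  forall K : R, exists2 L, 0 < L & forall t, L <= t -> K <= nmom F t.
Proof.
move=> EX K.
have lim : (\int[F]_y (npart n%:R y)%:E)%E @[n --> \oo] --> (+oo : \bar R)%E.
  have mm : measurable_fun [set: R] (fun y : R => (Num.max (- y) 0)%:E).
    by apply/measurable_EFinP; exact: measurable_maxr.
  have <- : (\int[F]_y (Num.max (- y) 0)%:E = +oo)%E.
    rewrite integral_law// -?EX ?unlock//.
    by move=> y; rewrite lee_fin le_max lexx orbT.
  rewrite (_ : (\int[F]_y (Num.max (- y) 0)%:E =
      \int[F]_y limn (fun n => (npart n%:R y)%:E))%E); last first.
    apply: eq_integral => y _; apply/esym/cvg_lim => //; apply: cvg_near_cst.
    exists (Num.bound `|- y|) => //= n /= yn; rewrite /npart min_l//.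
    rewrite ge_max ler0n andbT.
    by rewrite (le_trans (ler_norm _))// (le_trans (ltW (archi_boundP _)))// ler_nat.
  apply: cvg_monotone_convergence => //.
  - by move=> n; apply/measurable_EFinP; exact: measurable_npart.
  - by move=> n y _; rewrite lee_fin npart_ge0.
  - move=> y _ m n mn; rewrite lee_fin /npart le_min ge_min lexx/=.
    by rewrite ge_min ler_nat mn orbT.
have /cvgeyPge/(_ K)[n _ /(_ n.+1 (leqnSn n))] := lim.
rewrite /= nmomE// lee_fin => Kn; exists n.+1%:R => // t nt.
by rewrite (le_trans Kn)// le_nmom.
Qed.

Lemma mratio_integral : 
  (\int[F]_(x in `]0%R, +oo[%classic) (x / neg_trunc_mean X x)%:E =
   \int[F]_x (mratio F x)%:E)%E.
Proof.
rewrite integral_mkcond; apply: eq_integral => x _; rewrite patchE.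
rewrite (_ : (x \in _) = (0 < x)); last first.
  by apply/idP/idP; rewrite inE/= in_itv/= andbT.
by rewrite /mratio; case: ifPn => // x0; rewrite neg_trunc_meanE// ltW.
Qed.

Hypothesis nmomy : forall K : R, exists2 L, 0 < L & forall t, L <= t -> K <= nmom F t.

Lemma ratio_fun0_ge0 : 0 <= ratio_fun X 0.
Proof.
rewrite /ratio_fun ltxx; apply: lb_le_inf.
  by exists (1 / neg_trunc_mean X 1), 1 => //=; rewrite in_itv/= ltr01.
move=> _ /= [s + <-]; rewrite in_itv/= andbT => s0.
have sE := ltW s0; by rewrite neg_trunc_meanE// divr_ge0// nmom_ge0.
Qed.

Let lam := lebesgue_stieltjes_measure (ratio_fun X).

Lemma lam_itvoo_le c : 0 < c -> (lam `]0%R, c[%classic <= (mratio F c)%:E)%E.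
Proof.
move=> c0; apply: (@le_trans _ _ (lam `]0%R, c]%classic)).
  by apply: le_measure; rewrite ?inE//=; apply: subset_itvl; rewrite bnd_simp.
have cE := ltW c0; rewrite /lam lebesgue_stieltjes_itvoc// lee_fin /= ratio_fun_mratio//.
by rewrite gerBl ratio_fun0_ge0.
Qed.

Lemma lam_itvoo_ge : exists2 K : R, 0 <= K & forall c, 1 < c ->
  ((mratio F (c - 1) - K)%:E <= lam `]0%R, c[%classic)%E.
Proof.
exists (ratio_fun X 0); first exact: ratio_fun0_ge0.
move=> c c1; have c0 : 0 < c - 1 by rewrite subr_gt0.
have cE := ltW c0; rewrite -ratio_fun_mratio// -lebesgue_stieltjes_itvoc//.
apply: le_measure; rewrite ?inE//=.
by apply: subset_itvl; rewrite bnd_simp gtrBl.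
Qed.

End law_of_steps.

Lemma long_tailed_le (R : realType) (F : probability (measurableTypeR R) R) :
  long_tailed F -> forall a e : R, 0 < a -> 0 < e ->
  exists2 x0 : R, 0 < x0 & forall x, x0 <= x ->
  tail F x <= (1 + e) * tail F (x + a).
Proof.
move=> [Fpos Flim] a e a0 e0.
have d0 : 0 < e / (1 + e) by rewrite divr_gt0// addr_gt0.
have /cvgrPdist_le/(_ _ d0)[x0 [_ Hx0]] := Flim a.
exists (Num.max 1 (x0 + 1)); first by rewrite lt_max ltr01.
move=> x; rewrite ge_max => /andP[_ xx0].
have : `|1 - tail F (x + a) / tail F x| <= e / (1 + e).
  by apply: Hx0; rewrite (lt_le_trans _ xx0)// ltrDl.
rewrite ler_norml => /andP[_].
rewrite lerBlDl -lerBlDr (_ : 1 - e / (1 + e) = (1 + e)^-1); last first.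
  by field; rewrite gt_eqF// addr_gt0.
by rewrite ler_pdivlMr// ler_pdivrMl// addr_gt0.
Qed.

Lemma limf_esup_le (R : realType) (f : R -> \bar R) (c : \bar R) :
  (\forall x \near +oo%R, (f x <= c)%E) -> (limf_esup f +oo%R <= c)%E.
Proof.
move=> fc; rewrite limf_esupE; apply: (@le_trans _ _ (ereal_sup (f @` [set x | (f x <= c)%E]))).
  by apply: ereal_inf_lbound; exists [set x | (f x <= c)%E].
by apply: ge_ereal_sup => _ [x /= fx <-].
Qed.

Lemma limf_einf_ge (R : realType) (f : R -> \bar R) (c : \bar R) :
  (\forall x \near +oo%R, (c <= f x)%E) -> (c <= limf_einf f +oo%R)%E.
Proof.
move=> fc; rewrite limf_einfE; apply: (@le_trans _ _ (ereal_inf (f @` [set x | (c <= f x)%E]))).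
  by apply: le_ereal_inf_tmp => _ [x /= fx <-].
by apply: ereal_sup_ubound; exists [set x | (c <= f x)%E].
Qed.

(** The filter at infinity is proper, so that two of its sets always meet. *)
Lemma limf_einf_le_esup (R : realType) (f : R -> \bar R) :
  (limf_einf f +oo%R <= limf_esup f +oo%R)%E.
Proof.
rewrite limf_einfE limf_esupE; apply: ge_ereal_sup => _ [A Ay <-].
apply: le_ereal_inf_tmp => _ [B By <-].
have /filter_ex[x [Ax Bx]] : (\forall x \near +oo%R, A x /\ B x) by exact: filterI.
by apply: (@le_trans _ _ (f x)); [apply: ereal_inf_lbound|apply: ereal_sup_ubound]; exists x.
Qed.

Theorem theorem1 (d : measure_display) (T : measurableType d) (R : realType)
    (P : probability T R) (F : probability (measurableTypeR R) R)
    (* [xi 0] is the generic variable; the steps are [xi 1], [xi 2], and so on *)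
    (xi : nat -> {RV P >-> R})
    (G1 : probability (measurableTypeR R) R) :
  let m := neg_trunc_mean (xi 0%N) in
  let S (n : nat) (w : T) := \sum_(1 <= k < n.+1) xi k w in
  let M (w : T) := ereal_sup [set (S n w)%:E | n in [set: nat]] in
  let ratio (x : R) := (fine (P [set w | (x%:E < M w)%E]) / tail G1 x)%:E in
  independent_RVs xi ->
  (forall (k : nat) (B : set R), measurable B -> P (xi k @^-1` B) = F B) ->
  (forall a : R, F [set a] != 1%E) ->
  'E_P[(xi 0%N)^\-]%E = +oo%E ->
  (\int[F]_(x in `]0%R, +oo[) (x / m x)%:E < +oo)%E ->
  long_tailed F ->
  (forall x : R, 0 <= x ->
    (tail G1 x)%:E = Order.min 1%E
      (\int[lebesgue_stieltjes_measure (ratio_fun (xi 0%N))]_(t in `]0%R, +oo[)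
         (tail F (x + t))%:E)%E) ->
  subexponential G1 ->
  [/\ (1 <= limf_einf ratio +oo%R)%E,
      (limf_einf ratio +oo%R <= limf_esup ratio +oo%R)%E &
      (limf_esup ratio +oo%R <= 2%:E)%E].
Proof.
move=> m S M ratio xi_indep xi_law _ EX intF Flong G1E Gsub.
pose lam := lebesgue_stieltjes_measure (ratio_fun (xi 0%N)).
have nmomy := nmom_unbounded (xi_law 0%N) EX.
have lam_le := lam_itvoo_le (xi_law 0%N).
have lam_ge := lam_itvoo_ge (xi_law 0%N).
have intF' : (\int[F]_x (mratio F x)%:E < +oo)%E.
  by rewrite -(mratio_integral (xi_law 0%N)).
have Flong' (a e : R) : 0 < a -> 0 < e -> exists2 x0 : R, 0 < x0 &
    forall x, x0 <= x ->
    (F `]x, +oo[%classic <= (1 + e)%:E * F `](x + a)%R, +oo[%classic)%E.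
  move=> a0 e0; have [x0 x00 Hx0] := long_tailed_le Flong a0 e0.
  by exists x0 => // x /Hx0; rewrite !tailE -EFinM lee_fin.
have [x1 x10 itailG] : exists2 x1 : R, 0 < x1 &
    forall x, x1 <= x -> itail F lam x = (tail G1 x)%:E.
  have h0 : 0 < (2^-1 : R) by rewrite invr_gt0.
  have [x1 x10 Hx1] := prob_tail_small G1 h0.
  exists x1 => // x x1x; have x0 : 0 <= x by rewrite (le_trans (ltW x10)).
  rewrite G1E//.
  have -> : (\int[lam]_(t in `]0%R, +oo[) (tail F (x + t))%:E)%E = itail F lam x.
    by apply: eq_integral => t _; rewrite tailE.
  rewrite minEle; case: ifPn => // I1.
  have := G1E _ x0; rewrite minEle.
  have -> : (\int[lam]_(t in `]0%R, +oo[) (tail F (x + t))%:E)%E = itail F lam x.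
    by apply: eq_integral => t _; rewrite tailE.
  rewrite I1 => -[t1]; have := Hx1 _ x1x; rewrite t1 => h; exfalso; move: h; clear; lra.
have G_long (a e : R) : 0 < a -> 0 < e -> exists2 x0 : R, 0 < x0 &
    forall x, x0 <= x -> tail G1 x <= (1 + e) * tail G1 (x + a).
  move=> a0 e0; have [x0 x00 Hx0] := itail_long lam Flong' a0 e0.
  exists (Num.max x0 x1); first by rewrite lt_max x00.
  move=> x; rewrite ge_max => /andP[x0x x1x].
  rewrite -lee_fin EFinM -!itailG//; first exact: Hx0.
  by rewrite (le_trans x1x)// lerDl ltW.
have jump_G (e : R) : 0 < e <= 10^-1 -> exists2 z0 : R, 0 < z0 &
    forall N z s, z0 <= z -> 0 <= s ->
    (jump F z N s <= (2 * (1 + 6 * e) * tail G1 z)%:E)%E.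
  move=> e01; have [z0 z00 Hz0] := jump_le_itail nmomy lam_ge Flong' intF' e01.
  exists (Num.max z0 x1); first by rewrite lt_max z00.
  move=> N z s; rewrite ge_max => /andP[z0z x1z] s0.
  by rewrite EFinM -itailG//; exact: Hz0.
have hit0 := hit_vanish nmomy intF'.
pose p x := fine (P [set w | (x%:E < M w)%E]).
have pE x : 0 <= x -> P [set w | (x%:E < M w)%E] = (p x)%:E.
  move=> x0; rewrite /p fineK// ge0_fin_numE//.
  rewrite (le_lt_trans (probability_le1 _ _)) ?ltry//.
  exact: (measurable_supremum_gt xi x0).
have tG0 := tail_gt0 Gsub.
split; last 2 first.
- exact: limf_einf_le_esup.
- apply/lee_addgt0Pr => e e0; apply: limf_esup_le.
  have [x2 x20 Hx2] := hit_le_tail Gsub G_long jump_G hit0 e0.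
  exists x2; split; first exact: num_real.
  move=> x x2x; have x0 : 0 <= x by rewrite ltW// (lt_trans x20).
  rewrite /ratio -EFinD lee_fin ler_pdivrMr// -lee_fin -/(p x) -pE//.
  by apply: (supremum_le xi_indep xi_law x0) => n; apply: Hx2; exact: ltW.
apply/lee_subgt0Pr => e e0; apply: limf_einf_ge.
have [B B0 HB] := hit0 _ e0.
exists (Num.max B x1); split; first exact: num_real.
move=> x; rewrite gt_max => /andP[Bx x1x].
have x0 : 0 <= x by rewrite ltW// (lt_trans B0).
rewrite /ratio -EFinB lee_fin ler_pdivlMr// -/(p x).
have hp N : (hit F N x <= (p x)%:E)%E.
  by rewrite -pE//; exact: (hit_le_supremum xi_indep xi_law).
have pe : p x <= e.
  rewrite -lee_fin -pE//; apply: (supremum_le xi_indep xi_law x0) => N.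
  by apply: le_trans (HB N); apply: le_hit; exact: ltW.
have p1 : p x <= 1.
  by rewrite -lee_fin -pE//; apply: probability_le1; exact: (measurable_supremum_gt xi x0).
have := itail_le_hit nmomy lam_le x0 p1 hp; rewrite itailG ?(ltW x1x)// -EFinM lee_fin.
by apply: le_trans; rewrite ler_wpM2r ?(ltW (tG0 x))//; lra.
Qed.
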